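(* Let $A:\mathbb R^d\to\mathbb R^d$, $V:\mathbb R^d\to\mathbb R$ be time-independent smooth potentials such that all partial derivatives of order $\ge2$ of $V+\frac12|A|^2$ are bounded and all partial derivatives of order $\ge1$ of $A$ are bounded. Consider an $s$-stage explicit Runge--Kutta method $(L,b)$ of order $\nu$ with $b_i\neq0$ for all $i=1,\dots,s$, and apply the partitioned Runge--Kutta method with Butcher tableaus $(L,b)$ (for $\mathbf q$) and $(\hat L,b)$ (for $\mathbf p$), where $\hat L=\mathbf 1_sb^\top-\mathrm{diag}(b)^{-1}L^\top\mathrm{diag}(b)$, to the evolution of the magnetic Hamiltonian $\mathbf h_{\mathrm{mag}}(\mathbf q,\mathbf p)=-\mathbf A(\mathbf q)^\top\mathbf p$, that is, to $$\dot{\mathbf q}=-\mathbf A(\mathbf q),\qquad \dot{\mathbf p}=J_{\mathbf A}(\mathbf q)^\top\mathbf p .$$ If the numerical trajectory stays in a compact set $K\subset\mathbb R^{2D}$, then there is a constant $\tau_0>0$ that depends only on $L$, $b$, $K$ and the magnetic potential $A$ such that for step sizes $\tau\le\tau_0$ the integrator is well-defined, explicit, symplectic, and of order $\nu$.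
   Context: Let $d\in\mathbb N$ and $D=d+2d^2$. Write $\mathbf q=(q,\mathrm{vec}(X_1),\mathrm{vec}(X_2))\in\mathbb R^D$ with $q\in\mathbb R^d$, $X_1,X_2\in\mathbb R^{d\times d}$ (in the paper $X_1=\sqrt{\varepsilon/2}\,\mathrm{Re}\,Q$, $X_2=\sqrt{\varepsilon/2}\,\mathrm{Im}\,Q$ for the width matrix factor $Q$ of a Gaussian wave packet and semiclassical parameter $\varepsilon>0$); $\mathrm{vec}$ stacks columns. For a function $f$ on $\mathbb R^d$ (scalar, vector or matrix valued) set $$\langle f\rangle(\mathbf q)=(2\pi)^{-d}\int_{\mathbb R^{2d}}f(q+X_1\zeta_1+X_2\zeta_2)\,e^{-\frac12(|\zeta_1|^2+|\zeta_2|^2)}\,d\zeta_1d\zeta_2 .$$ The averaged vector potential is $\mathbf A(\mathbf q)=\big(\langle A\rangle,\ \mathrm{vec}(\langle J_A\rangle X_1),\ \mathrm{vec}(\langle J_A\rangle X_2)\big)\in\mathbb R^D$, with $J_A$ the Jacobi matrix of $A$; $J_{\mathbf A}(\mathbf q)\in\mathbb R^{D\times D}$ is the Jacobi matrix of $\mathbf A$. The partitioned method with step size $\tau>0$: with $L=(l_{ij})$ strictly lower triangular, $\hat L=(\hat l_{ij})$, $\mathbf 1_s$ the vector of ones, $$\mathbf q_{n+1}=\mathbf q_n+\tau\sum_{i=1}^sb_i\mathbf k^{(i)},\quad \mathbf p_{n+1}=\mathbf p_n+\tau\sum_{i=1}^sb_i\boldsymbol\ell^{(i)},$$ $$\mathbf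 k^{(i)}=-\mathbf A\Big(\mathbf q_n+\tau\sum_{j<i}l_{ij}\mathbf k^{(j)}\Big),\quad \boldsymbol\ell^{(i)}=M_n^{(i)}\Big(\mathbf p_n+\tau\sum_{j=1}^s\hat l_{ij}\boldsymbol\ell^{(j)}\Big),\quad M_n^{(i)}=J_{\mathbf A}\Big(\mathbf q_n+\tau\sum_{j<i}l_{ij}\mathbf k^{(j)}\Big)^\top .$$ ''Well-defined'' means that the (linear) system for the momentum stages is uniquely solvable; ''explicit'' means that a step requires no solution of nonlinear equations: the position update is computed by successive evaluations of $\mathbf A$, and the momentum update is $\mathbf p_{n+1}=(\mathrm{Id}_D+\rho)^{-1}\mathbf p_n$ with a matrix $\rho\in\mathbb R^{D\times D}$ that is a polynomial expression in $\tau M_n^{(1)},\dots,\tau M_n^{(s)}$; ''symplectic'' refers to the standard symplectic form on $\mathbb R^{2D}$ in the coordinates $(\mathbf q,\mathbf p)$; ''order $\nu$'' means local error $O(\tau^{\nu+1})$. *)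

(* Defs.v *)
From HB Require Import structures.
From mathcomp Require Import all_boot all_order all_algebra.
From mathcomp Require Import all_classical all_reals all_analysis.

Set Implicit Arguments.
Unset Strict Implicit.
Unset Printing Implicit Defensive.

Import Order.TTheory GRing.Theory Num.Theory.
Import numFieldNormedType.Exports.

Local Open Scope classical_set_scope.
Local Open Scope ring_scope.

Lemma product_sigma_finite d1 d2 (T1 : measurableType d1)
    (T2 : measurableType d2) (R : realType)
    (m1 : {sigma_finite_measure set T1 -> \bar R})
    (m2 : {sigma_finite_measure set T2 -> \bar R}) :
  sigma_finite setT (m1 \x m2)%E.
Proof.
have /sigma_finiteP[F [TF ndF Foo]] := sigma_finiteT m1.
have /sigma_finiteP[G [TG ndG Goo]] := sigma_finiteT m2.
exists (fun n => F n `*` G n).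
  rewrite -setXTT TF TG predeqE => -[x y]; split.
    move=> [/= [n _ Fnx] [k _ Gky]]; exists (maxn n k) => //; split.
    - by move: x Fnx; exact/subsetPset/ndF/leq_maxl.
    - by move: y Gky; exact/subsetPset/ndG/leq_maxr.
  by move=> [n _ []/= ? ?]; split; exists n.
move=> k; have [? ?] := Foo k; have [? ?] := Goo k.
split; first exact: measurableX.
by rewrite product_measure1E// lte_mul_pinfty// ge0_fin_numE.
Qed.

Section lebesgue_cons.
Context (R : realType) (n : nat).
Local Notation mR := (measurableTypeR R).
Variable mu : {sigma_finite_measure set n.-tuple mR -> \bar R}.

Definition tuple_cons (z : mR * n.-tuple mR) : n.+1.-tuple mR :=
  [tuple of z.1 :: z.2].

Lemma measurable_tuple_cons : measurable_fun setT tuple_cons.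
Proof. exact: measurable_cons. Qed.

Definition lebesgue_cons : set (n.+1.-tuple mR) -> \bar R :=
  pushforward (@lebesgue_measure R \x mu)%E tuple_cons.

Let lebesgue_cons0 : lebesgue_cons set0 = 0%E.
Proof. by rewrite /lebesgue_cons /pushforward preimage_set0 measure0. Qed.

Let lebesgue_cons_ge0 A : (0 <= lebesgue_cons A)%E.
Proof. by rewrite /lebesgue_cons /pushforward; exact: measure_ge0. Qed.

Let lebesgue_cons_sigma_additive : semi_sigma_additive lebesgue_cons.
Proof.
have mc := measurable_tuple_cons.
move=> F mF tF mUF; rewrite /lebesgue_cons /pushforward preimage_bigcup.
apply: measure_semi_sigma_additive.
- by move=> k; rewrite -[X in measurable X]setTI; exact: mc.
- apply/trivIsetP => /= i j _ _ ij; rewrite -preimage_setI.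
  by move/trivIsetP : tF => /(_ _ _ _ _ ij) ->//; rewrite preimage_set0.
- by rewrite -preimage_bigcup -[X in measurable X]setTI; exact: mc.
Qed.

HB.instance Definition _ := isMeasure.Build _ _ _ lebesgue_cons
  lebesgue_cons0 lebesgue_cons_ge0 lebesgue_cons_sigma_additive.

Let lebesgue_cons_sigma_finite : sigma_finite setT lebesgue_cons.
Proof.
have [F UF F_oo] := product_sigma_finite (@lebesgue_measure R) mu.
pose u (t : n.+1.-tuple mR) : mR * n.-tuple mR :=
  (tnth t ord0, [tuple of behead t]).
have mu_ : measurable_fun setT u.
  apply: measurable_fun_pair; first exact: measurable_tnth.
  exact: measurable_behead.
have cK z : u (tuple_cons z) = z.
  by case: z => x t; rewrite /u; congr (_, _); exact/val_inj.
exists (fun i => u @^-1` F i).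
  by rewrite -preimage_bigcup -UF preimage_setT.
move=> i; split.
  by rewrite -[X in measurable X]setTI; apply: mu_ => //; exact: (F_oo i).1.
rewrite /lebesgue_cons /pushforward -comp_preimage.
rewrite (_ : _ @^-1` _ = F i); first exact: (F_oo i).2.
by apply/seteqP; split => z /=; rewrite cK.
Qed.

HB.instance Definition _ := Measure_isSigmaFinite.Build _ _ _ lebesgue_cons
  lebesgue_cons_sigma_finite.

End lebesgue_cons.

(* Lebesgue measure on R^n, as the n-fold product of the one-dimensional one. *)
Fixpoint lebesgue_tuple (R : realType) (n : nat) :
    {sigma_finite_measure set n.-tuple (measurableTypeR R) -> \bar R} :=
  if n is m.+1 then lebesgue_cons (lebesgue_tuple R m)
  else \d_([tuple] : 0.-tuple (measurableTypeR R)).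

Section differential_notions.
Context (R : realType).

Definition partial (d : nat) (f : 'cV[R]_d -> R) (i : 'I_d) : 'cV[R]_d -> R :=
  fun x => 'D_(delta_mx i 0) f x.

Definition partials (d : nat) (f : 'cV[R]_d -> R) (I : seq 'I_d) :
    'cV[R]_d -> R :=
  foldl (@partial d) f I.

Definition smooth (d : nat) (f : 'cV[R]_d -> R) : Prop :=
  forall I : seq 'I_d, continuous (partials f I) /\
    forall x i, derivable (partials f I) x (delta_mx i 0).

Definition smooth_field (d m : nat) (f : 'cV[R]_d -> 'cV[R]_m) : Prop :=
  forall i, smooth (fun x => f x i 0).

Definition bounded_partials (d : nat) (k : nat) (f : 'cV[R]_d -> R) : Prop :=
  forall I : seq 'I_d, (k <= size I)%N ->
    exists C : R, forall x, `|partials f I x| <= C.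

(* The library's [jacobian] acts on row vectors on the right, hence is the
   transpose of the Jacobi matrix used here. *)
Definition jacobi (d m : nat) (f : 'cV[R]_d -> 'cV[R]_m) (x : 'cV[R]_d) :
    'M[R]_(m, d) :=
  \matrix_(i, j) partial (fun y => f y i 0) j x.

Definition sqnorm (d : nat) (v : 'cV[R]_d) : R := \sum_i v i 0 ^+ 2.

End differential_notions.

Section averaging.
Context (R : realType) (d : nat).

(* [mxvec] concatenates rows; [vec] stacks columns. *)
Definition vec (X : 'M[R]_d) : 'cV[R]_(d * d) := (mxvec X^T)^T.
Definition unvec (v : 'cV[R]_(d * d)) : 'M[R]_d := (vec_mx v^T)^T.

Definition dimD : nat := d + (d * d + d * d).

Definition pos (x : 'cV[R]_dimD) : 'cV[R]_d :=
  usubmx (x : 'cV_(d + (d * d + d * d))).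
Definition wid1 (x : 'cV[R]_dimD) : 'M[R]_d :=
  unvec (usubmx (dsubmx (x : 'cV_(d + (d * d + d * d))))).
Definition wid2 (x : 'cV[R]_dimD) : 'M[R]_d :=
  unvec (dsubmx (dsubmx (x : 'cV_(d + (d * d + d * d))))).

Definition col_of_tuple (z : d.-tuple (measurableTypeR R)) : 'cV[R]_d :=
  \col_i tnth z i.

Definition avg (f : 'cV[R]_d -> R) (x : 'cV[R]_dimD) : R :=
  ((2 * pi) ^+ d)^-1 *
  \int[(lebesgue_tuple R d \x lebesgue_tuple R d)%E]_z
    (f (pos x + wid1 x *m col_of_tuple z.1 + wid2 x *m col_of_tuple z.2) *
     expR (- (1 / 2) *
       (sqnorm (col_of_tuple z.1) + sqnorm (col_of_tuple z.2)))).

Definition avg_mx (m n : nat) (F : 'cV[R]_d -> 'M[R]_(m, n))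
    (x : 'cV[R]_dimD) : 'M[R]_(m, n) :=
  \matrix_(i, j) avg (fun y => F y i j) x.

Definition avg_potential (A : 'cV[R]_d -> 'cV[R]_d) (x : 'cV[R]_dimD) :
    'cV[R]_dimD :=
  col_mx (avg_mx A x)
    (col_mx (vec (avg_mx (jacobi A) x *m wid1 x))
            (vec (avg_mx (jacobi A) x *m wid2 x))).

End averaging.

Section runge_kutta.
Context (R : realType) (s : nat).
Implicit Types (L Lh : 'M[R]_s) (b : 'cV[R]_s) (tau : R) (nu : nat).

Definition strictly_lower L : Prop := forall i j : 'I_s, (i <= j)%N -> L i j = 0.

Definition stage_point m L tau (q : 'cV[R]_m) (k : 'I_s -> 'cV[R]_m)
    (i : 'I_s) : 'cV[R]_m :=
  q + tau *: \sum_(j < s | (j < i)%N) L i j *: k j.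

Definition rk_stages m (f : 'cV[R]_m -> 'cV[R]_m) L tau (q : 'cV[R]_m)
    (k : 'I_s -> 'cV[R]_m) : Prop :=
  forall i, k i = f (stage_point L tau q k i).

Definition rk_update m b tau (q : 'cV[R]_m) (k : 'I_s -> 'cV[R]_m) :
    'cV[R]_m :=
  q + tau *: \sum_i b i 0 *: k i.

(* The stages obtained by n successive evaluations of f. *)
Fixpoint rk_eval m (f : 'cV[R]_m -> 'cV[R]_m) L tau (q : 'cV[R]_m) (n : nat) :
    'I_s -> 'cV[R]_m :=
  if n is n'.+1 then
    let k := rk_eval f L tau q n' in
    fun i => if i == n' :> nat then f (stage_point L tau q k i) else k i
  else fun=> 0.

Definition is_solution m (f : 'cV[R]_m -> 'cV[R]_m) (T : R)
    (y : R -> 'cV[R]_m) : Prop :=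
  forall t : R, 0 <= t <= T -> is_derive t (1 : R) y (f (y t)).

(* Local error O(tau^(nu+1)), locally uniformly in the initial value, for all
   autonomous smooth systems. *)
Definition rk_order L b nu : Prop :=
  forall (m : nat) (f : 'cV[R]_m -> 'cV[R]_m), smooth_field f ->
  forall K : set 'cV[R]_m, compact K ->
  exists C tau1 : R, 0 < tau1 /\
    forall tau (y : R -> 'cV[R]_m) (k : 'I_s -> 'cV[R]_m),
      0 < tau <= tau1 -> K (y 0) -> is_solution f tau y ->
      rk_stages f L tau (y 0) k ->
      `|y tau - rk_update b tau (y 0) k| <= C * tau ^+ nu.+1.

Definition symplectic_companion L b : 'M[R]_s :=
  (const_mx 1 : 'cV[R]_s) *m b^T
  - invmx (diag_mx b^T) *m L^T *m diag_mx b^T.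

Inductive ncpoly : Type :=
| NCconst of R
| NCvar of 'I_s
| NCadd of ncpoly & ncpoly
| NCmul of ncpoly & ncpoly.

Fixpoint nceval m (M : 'I_s -> 'M[R]_m) (P : ncpoly) : 'M[R]_m :=
  match P with
  | NCconst c => c%:M
  | NCvar i => M i
  | NCadd P1 P2 => nceval M P1 + nceval M P2
  | NCmul P1 P2 => nceval M P1 *m nceval M P2
  end.

(* The partitioned method (L, b), (Lh, b) for
   q' = - a q, p' = (J_a q)^T p, with state col_mx q p. *)
Section partitioned.
Context (m : nat) (a : 'cV[R]_m -> 'cV[R]_m).
Implicit Types (q p : 'cV[R]_m) (k l : 'I_s -> 'cV[R]_m)
  (z w : 'cV[R]_(m + m)).

Definition magnetic_field z : 'cV[R]_(m + m) :=
  col_mx (- a (usubmx z)) ((jacobi a (usubmx z))^T *m dsubmx z).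

Definition pos_stages L tau q k : Prop := rk_stages (fun x => - a x) L tau q k.

Definition stage_mx L tau q k (i : 'I_s) : 'M[R]_m :=
  (jacobi a (stage_point L tau q k i))^T.

Definition mom_stages L Lh tau q p k l : Prop :=
  forall i, l i = stage_mx L tau q k i *m (p + tau *: \sum_j Lh i j *: l j).

Definition prk_step L Lh b tau z w : Prop :=
  exists k l, [/\ pos_stages L tau (usubmx z) k,
    mom_stages L Lh tau (usubmx z) (dsubmx z) k l &
    w = col_mx (rk_update b tau (usubmx z) k) (rk_update b tau (dsubmx z) l)].

Definition prk_trajectory L Lh b tau (N : nat) (z : nat -> 'cV[R]_(m + m)) :
    Prop :=
  forall n, (n < N)%N -> prk_step L Lh b tau (z n) (z n.+1).

Definition prk_well_defined L Lh tau z : Prop :=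
  forall k, pos_stages L tau (usubmx z) k ->
    exists! l, mom_stages L Lh tau (usubmx z) (dsubmx z) k l.

Definition prk_explicit L Lh b tau (P : ncpoly) z : Prop :=
  (forall k, pos_stages L tau (usubmx z) k <->
     k =1 rk_eval (fun x => - a x) L tau (usubmx z) s) /\
  forall k l, pos_stages L tau (usubmx z) k ->
    mom_stages L Lh tau (usubmx z) (dsubmx z) k l ->
    let rho := nceval (fun i => tau *: stage_mx L tau (usubmx z) k i) P in
    1%:M + rho \in unitmx /\
    rk_update b tau (dsubmx z) l = invmx (1%:M + rho) *m dsubmx z.

Definition symplectic_mx : 'M[R]_(m + m) := block_mx 0 1%:M (- 1%:M) 0.

(* Near z the step relation is the graph of a map whose differential at z
   preserves the standard symplectic form. *)
Definition prk_symplectic L Lh b tau z : Prop :=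
  exists Phi : 'cV[R]_(m + m) -> 'cV[R]_(m + m),
    [/\ \forall z' \near z, forall w, prk_step L Lh b tau z' w <-> w = Phi z',
        differentiable Phi z &
        (jacobi Phi z)^T *m symplectic_mx *m jacobi Phi z = symplectic_mx].

Definition prk_local_error_le L Lh b tau z (e : R) : Prop :=
  forall (y : R -> 'cV[R]_(m + m)) w,
    y 0 = z -> is_solution magnetic_field tau y ->
    prk_step L Lh b tau z w -> `|y tau - w| <= e.

End partitioned.
End runge_kutta.

(* Main.v *)
Require Import Defs.
From HB Require Import structures.
From mathcomp Require Import all_boot all_order all_algebra.
From mathcomp Require Import all_classical all_reals all_analysis.
From mathcomp Require Import measurable_realfun ring lra.

Set Implicit Arguments.
Unset Strict Implicit.
Unset Printing Implicit Defensive.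

Import Order.TTheory GRing.Theory Num.Theory.
Import numFieldNormedType.Exports.

Local Open Scope classical_set_scope.
Local Open Scope ring_scope.

(** Write f = - a, let Psi be the map that one step of the explicit method (L, b)
    performs on the positions, and let B(q) be the transposed Jacobi matrix of Psi
    at q. Differentiating the recursion of the stages shows B = 1 + rho, where rho
    is a fixed noncommutative polynomial in the matrices tau M_i, M_i being the
    transposed Jacobi matrix of a at the i-th stage ([rho_poly],
    [num_flow_partial]).

    The whole proof rests on one identity: for the weights chosen for the momenta,
    every solution of the momentum stages satisfies B p1 = p, where p1 is the new
    momentum ([momentum_conservation]). This is the discrete form of the
    conservation of the pairing of solutions of the linearized equation and of its
    adjoint. Conversely p1 determines the stages by backward substitution. Hence
    the momentum system is uniquely solvable when B is invertible
    ([momentum_stages_unique]), the momentum update is p1 = B^-1 p, and the step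
    map is the cotangent lift (q, p) |-> (Psi q, B(q)^-1 p) of Psi. The lift of
    a map of class C^2 with invertible derivative is symplectic, by the symmetry
    of second derivatives ([cotangent_lift_symplectic]).

    For the order, the assumption on (L, b) is applied to the position equation
    together with its linearization. On that system the method computes Psi q and
    B^T d, and the exact solution d(t) of the linearized equation has a constant
    pairing with p(t). So B p(tau) - p(0) is, coordinate by coordinate, an error
    of the method for that system paired with p(tau) ([momentum_error]). The
    solution d(t) exists for short times by Picard iteration
    ([linear_ode_exists]).

    The step size bound comes from compactness: B is jointly continuous in tau
    and q and equals 1 at tau = 0, so it is invertible on the compact set for
    small tau ([num_tangent_unit]); a second condition on tau keeps the exact
    solutions in a fixed ball ([solution_stays]), which bounds them uniformly.

    All of this needs the averaged potential a to be smooth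
    ([avg_potential_smooth]). The evaluation point of the Gaussian average depends
    linearly on the parameters, so each parameter derivative falls on the averaged
    function and multiplies the Gaussian weight by a polynomial; the derivatives
    of A being bounded, all resulting integrals converge. *)

(** * Coordinates, and differentiation along lines *)

Section norm_coordinates.
Context {R : realType}.

Lemma continuous_mul (T : topologicalType) (f g : T -> R) x :
  {for x, continuous f} -> {for x, continuous g} ->
  {for x, continuous (fun y => f y * g y)}.
Proof. by move=> cf cg; have := continuousM cf cg. Qed.

Lemma continuous_sum (T : topologicalType) (V : normedModType R) I (r : seq I)
    (P : pred I) (f : I -> T -> V) x :
  (forall i, P i -> {for x, continuous (f i)}) ->
  {for x, continuous (fun y => \sum_(i <- r | P i) f i y)}.
Proof.
move=> cf; elim: r => [|i r IH].
  rewrite (_ : (fun _ => _) = cst 0); first exact: cst_continuous.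
  by apply/funext => y; rewrite big_nil.
rewrite (_ : (fun _ => _) = if P i then f i + (fun y => \sum_(j <- r | P j) f j y)
    else (fun y => \sum_(j <- r | P j) f j y)).
  by case: ifP => [/cf Pi|_ //]; exact: continuousD.
by apply/funext => y; rewrite big_cons; case: ifP.
Qed.

Lemma coord_le_norm m n (x : 'M[R]_(m, n)) i j : `|x i j| <= `|x|.
Proof.
rewrite [leRHS]/Num.Def.normr/= mx_normrE.
exact: (le_bigmax _ (fun ij : 'I_m * 'I_n => `|x ij.1 ij.2|) (i, j)).
Qed.

Lemma norm_le_coord m n (x : 'M[R]_(m, n)) (e : R) : 0 <= e ->
  (forall i j, `|x i j| <= e) -> `|x| <= e.
Proof.
move=> e0 xe; rewrite /Num.Def.normr/= mx_normrE.
by apply: bigmax_le => // -[i j] _.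
Qed.

Lemma continuous_mxP (T : topologicalType) m n (f : T -> 'M[R]_(m, n)) x :
  (forall i j, {for x, continuous (fun y => f y i j)}) -> {for x, continuous f}.
Proof.
move=> fc; apply/cvgrPdist_le => /= e e0.
near=> y; apply: norm_le_coord; first exact: ltW.
move=> i j; rewrite !mxE.
suff : forall ij : 'I_m * 'I_n, `|f x ij.1 ij.2 - f y ij.1 ij.2| <= e.
  by move=> /(_ (i, j)).
near: y; apply: filter_forall => -[k l] /=.
by have /cvgrPdist_le := fc k l; exact.
Unshelve. all: by end_near. Qed.

Lemma col_sum_delta n (x : 'cV[R]_n) : x = \sum_i x i 0 *: (delta_mx i 0 : 'cV_n).
Proof. by rewrite {1}(matrix_sum_delta x); apply: eq_bigr => i _; rewrite big_ord1. Qed.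

End norm_coordinates.

Section directional_derivative.
Context {R : realType}.

Lemma is_derive_line (V W : normedModType R) (f : V -> W) (u v : V) (s : R) :
  derivable f (u + s *: v) v ->
  is_derive s (1 : R) (fun t => f (u + t *: v)) ('D_v f (u + s *: v)).
Proof.
move=> df.
have E : (fun h : R => h^-1 *: (((fun t => f (u + t *: v)) \o shift s) (h *: 1)
     - f (u + s *: v))) =
   (fun h => h^-1 *: ((f \o shift (u + s *: v)) (h *: v) - f (u + s *: v))).
  apply/funext => h /=; congr (_ *: (f _ - _)).
  by rewrite [h *: 1]mulr1 scalerDl addrCA.
by split; rewrite /derivable /derive ?E.
Qed.

Lemma derive_translate (V W : normedModType R) (f : V -> W) (w x v : V) :
  'D_v (fun y => f (y + w)) x = 'D_v f (x + w).
Proof.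
rewrite /derive (_ : (fun h : R => _) =
   (fun h => h^-1 *: ((f \o shift (x + w)) (h *: v) - f (x + w)))) //.
by apply/funext => h /=; rewrite addrA.
Qed.

Lemma derive_line0 (V W : normedModType R) (f : V -> W) (x v : V) :
  'D_v f x = 'D_1 (fun h : R => f (h *: v + x)) 0.
Proof.
rewrite /derive; set g1 := fun h => h^-1 *: _; set g2 := fun h => h^-1 *: _.
suff -> : g1 = g2 by [].
by rewrite funeqE /g1 /g2 => h /=; rewrite addr0 scale0r add0r [_%:A]mulr1.
Qed.

(** The signed step t spares a case distinction at each use of the mean value
    theorem. *)
Lemma MVT_line (V : normedModType R) (f : V -> R) (u v : V) (t : R) :
  (forall s, derivable f (u + s *: v) v) ->
  exists2 c, `|c| <= `|t| & f (u + t *: v) - f u = t * 'D_v f (u + c *: v).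
Proof.
move=> df; pose g s := f (u + s *: v).
have dg (s : R) : is_derive s (1 : R) g ('D_v f (u + s *: v)) by exact: is_derive_line.
have cg (A : set R) : {within A, continuous g}.
  apply: continuous_subspaceT => s.
  by apply/differentiable_continuous/derivable1_diffP; exact: ex_derive.
have -> : f u = g 0 by rewrite /g scale0r addr0.
rewrite -/(g t).
have [t0|t0|<-] := ltgtP 0 t.
- have [c] := MVT t0 (fun x _ => dg x) (cg _).
  rewrite in_itv /= => /andP[c0 ct] ->; exists c.
    by rewrite !gtr0_norm// ltW.
  by rewrite subr0 mulrC.
- have [c] := MVT t0 (fun x _ => dg x) (cg _).
  rewrite in_itv /= => /andP[c0 ct] E; exists c.
    by rewrite !ltr0_norm// lerN2 ltW.
  by rewrite -[LHS]opprB E sub0r mulrN opprK mulrC.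
- by exists 0; rewrite ?normr0 ?subrr ?mul0r.
Qed.

Lemma differentiable_estimate (V W : normedModType R) (f : V -> W) (x : V)
    (df : {linear V -> W}) :
  continuous df ->
  (forall e, 0 < e -> \forall h \near (0 : V),
     `|f (h + x) - f x - df h| <= e * `|h|) ->
  differentiable f x.
Proof.
move=> cdf H.
have E : f \o shift x = cst (f x) + df +o_ 0 id.
  apply/eqaddoP => e e0; have := H e e0.
  apply: filterS => h /= Hh.
  by rewrite opprD addrA.
by apply/diff_locallyP; rewrite (diff_unique cdf E); split => //.
Qed.

End directional_derivative.

Section partial_derivatives.
Context {R : realType}.

(** The increment from x to x + h is a sum of increments along the coordinate
    axes; the mean value theorem turns each into a partial derivative at a point
    near x, where it differs little from its value at x. *)
Lemma differentiable_partials n (f : 'cV[R]_n -> R) (x : 'cV[R]_n) :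
  (forall y i, derivable f y (delta_mx i 0)) ->
  (forall i, {for x, continuous (partial f i)}) -> differentiable f x.
Proof.
move=> df cf.
pose dfx := fun h : 'cV[R]_n => \sum_i h i 0 * partial f i x.
have dfl : linear dfx.
  move=> k u v; rewrite /dfx scaler_sumr -big_split /=; apply: eq_bigr => i _.
  by rewrite !mxE mulrDl -scalerAl.
pose dfL : {linear 'cV[R]_n -> R} :=
  HB.pack dfx (GRing.isLinear.Build _ _ _ _ dfx dfl).
apply: (@differentiable_estimate _ _ _ _ _ dfL).
  move=> h; rewrite /dfL/= /dfx.
  apply: (@continuous_sum _ _ R^o) => i _.
  have C := @coord_continuous R n 1 i 0 h; exact: (cvgMr_tmp C).
move=> e e0.
pose d := e / n.+1%:R.
have d0 : 0 < d by rewrite divr_gt0// ltr0n.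
have Hi i : nbhs x [set y | `|partial f i x - partial f i y| <= d].
  by have /cvgrPdist_le := cf i; exact.
have [r /= r0 Hr] : nbhs_ball x [set y | forall i, `|partial f i x - partial f i y| <= d].
  by apply/nbhs_ballP; exact: filter_forall Hi.
near=> h.
have hr : `|h| < r by near: h; exact: (@nbhs0_lt _ 'cV[R]_n r r0).
(* the path from x to x + h along the coordinate axes *)
pose u (k : nat) : 'cV[R]_n := x + \sum_(i < n | (i < k)%N) h i 0 *: delta_mx i 0.
have u0 : u 0 = x by rewrite /u big_pred0 ?addr0.
have un : u n = h + x.
  rewrite /u addrC [in RHS](col_sum_delta h); congr (_ + _).
  by apply: eq_bigl => i; rewrite ltn_ord.
have uS (i : 'I_n) : u i.+1 = u i + h i 0 *: delta_mx i 0.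
  rewrite /u -addrA; congr (_ + _).
  rewrite (bigD1 i) //= addrC; congr (_ + _); apply: eq_bigl => j.
  by rewrite ltnS ltn_neqAle andbC.
have T : f (h + x) - f x = \sum_(i < n) (f (u i.+1) - f (u i)).
  by rewrite -(big_mkord predT (fun i => f (u i.+1) - f (u i)))
    telescope_sumr // un u0.
rewrite T /= /dfx -sumrB.
apply: le_trans (ler_norm_sum _ _ _) _.
apply: (@le_trans _ _ (\sum_(i < n) d * `|h|)); last first.
  rewrite sumr_const card_ord -mulr_natl mulrA ler_wpM2r//.
  by rewrite mulrA ler_pdivrMr ?ltr0n// mulrC ler_wpM2l ?(ltW e0)// ler_nat.
apply: ler_sum => i _.
have [c ch ->] : exists2 c, `|c| <= `|h i 0| &
    f (u i.+1) - f (u i) = h i 0 * partial f i (u i + c *: delta_mx i 0).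
  by rewrite uS; apply: MVT_line => s; exact: df.
rewrite -mulrBr normrM mulrC ler_pM//; last exact: coord_le_norm.
rewrite distrC; apply: Hr.
rewrite -ball_normE /= /u opprD addrA opprD addrA subrr sub0r -opprD normrN.
apply: le_lt_trans hr; apply: norm_le_coord => // k l.
rewrite !mxE summxE ord1.
have ES : \sum_(j < n | (j < i)%N) (h j 0 *: (delta_mx j 0 : 'cV[R]_n)) k 0 =
   (if (k < i)%N then h k 0 else 0).
  case: ifP => ki.
    rewrite (bigD1 k) //= !mxE !eqxx mulr1 big1 ?addr0// => j /andP[_ jk].
    by rewrite !mxE eq_sym (negbTE jk) mulr0.
  rewrite big1 // => j ji; rewrite !mxE andbT.
  by case: eqP => [kj|_]; [move: ji; rewrite -kj ki|rewrite mulr0].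
rewrite ES ?eqxx ?andbT; have [ki|ki] := eqVneq k i.
  by rewrite ki ltnn add0r mulr1 (le_trans ch)// coord_le_norm.
by rewrite mulr0 addr0; case: ifP => _; rewrite ?normr0// coord_le_norm.
Unshelve. all: by end_near. Qed.

End partial_derivatives.

(** * Functions of class C^k of several variables *)

Section smoothness.
Context {R : realType}.

(** Being k times continuously differentiable, by recursion on k: each proof
    below that a class of functions is closed under an operation is then an
    induction using only the first derivative of that operation. *)
Fixpoint Ck (k : nat) n (f : 'cV[R]_n -> R) : Prop :=
  if k is k'.+1 then
    (forall x, differentiable f x) /\ forall i, Ck k' (partial f i)
  else continuous f.

Lemma Ck_continuous k n (f : 'cV[R]_n -> R) : Ck k f -> continuous f.
Proof. by case: k => [//|k] [df _] x; exact: differentiable_continuous. Qed.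

Lemma CkW k n (f : 'cV[R]_n -> R) : Ck k.+1 f -> Ck k f.
Proof.
elim: k f => [|k IH] f Cf; first exact: Ck_continuous Cf.
by split=> [|i]; [exact: Cf.1|exact/IH/Cf.2].
Qed.

Lemma smoothP n (f : 'cV[R]_n -> R) : smooth f <-> forall k, Ck k f.
Proof.
split=> [sf k|Cf I].
  suff H I : Ck k (partials f I) by exact: (H [::]).
  elim: k I => [|k IH] I /=; first exact: (sf I).1.
  have E i : partial (partials f I) i = partials f (rcons I i).
    by rewrite /partials -cats1 foldl_cat.
  split=> [x|i]; last by rewrite E.
  apply: differentiable_partials => [y i|i]; first exact: (sf I).2.
  by rewrite E; move: x; exact: (sf _).1.
have {Cf} Cf : forall k, Ck k (partials f I).
  elim: I f Cf => [//|i I IH] f Cf /=; apply: IH => k.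
  exact: (Cf k.+1).2.
split=> [|x i]; first exact: (Cf 0).
by apply: diff_derivable; have [+ _] := Cf 1; exact.
Qed.

Lemma Ck_cst k n (c : R) : Ck k (fun _ : 'cV[R]_n => c).
Proof.
elim: k c => [|k IH] c; first exact: cst_continuous.
split=> [x|i]; first exact: differentiable_cst.
rewrite (_ : partial _ i = fun=> 0); first exact: IH.
by apply/funext => x; exact: derive_cst.
Qed.

Lemma CkD k n (f g : 'cV[R]_n -> R) :
  Ck k f -> Ck k g -> Ck k (fun x => f x + g x).
Proof.
elim: k f g => [|k IH] f g; first by move=> cf cg x; exact: (cvgD (cf x) (cg x)).
move=> [df cf] [dg cg]; split=> [x|i]; first exact: differentiableD.
rewrite (_ : partial _ i = fun x => partial f i x + partial g i x).
  exact: IH (cf i) (cg i).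
by apply/funext => x; apply: deriveD; exact: diff_derivable.
Qed.

Lemma CkM k n (f g : 'cV[R]_n -> R) :
  Ck k f -> Ck k g -> Ck k (fun x => f x * g x).
Proof.
elim: k f g => [|k IH] f g; first by move=> cf cg x; exact: (cvgM (cf x) (cg x)).
move=> Cf Cg; have [df cf] := Cf; have [dg cg] := Cg.
split=> [x|i]; first exact: differentiableM.
rewrite (_ : partial _ i = fun x => f x * partial g i x + g x * partial f i x).
  apply: CkD; first exact: IH (CkW Cf) (cg i).
  exact: IH (CkW Cg) (cf i).
by apply/funext => x; apply: deriveM; exact: diff_derivable.
Qed.

Lemma CkZ k n c (f : 'cV[R]_n -> R) : Ck k f -> Ck k (fun x => c * f x).
Proof. by move=> Cf; apply: CkM => //; exact: Ck_cst. Qed.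

Lemma CkN k n (f : 'cV[R]_n -> R) : Ck k f -> Ck k (fun x => - f x).
Proof.
move=> /(CkZ (-1)).
by rewrite (_ : (fun _ => _) = fun x => - f x)//; apply/funext => x; rewrite mulN1r.
Qed.

Lemma Ck_sum k n I (r : seq I) (P : pred I) (f : I -> 'cV[R]_n -> R) :
  (forall i, P i -> Ck k (f i)) -> Ck k (fun x => \sum_(i <- r | P i) f i x).
Proof.
move=> Cf; elim: r => [|i r IH].
  rewrite (_ : (fun _ => _) = fun=> 0); first exact: Ck_cst.
  by apply/funext => x; rewrite big_nil.
rewrite (_ : (fun _ => _) = if P i
    then (fun x => f i x + \sum_(j <- r | P j) f j x)
    else (fun x => \sum_(j <- r | P j) f j x)).
  by case: ifP => // Pi; apply: CkD => //; exact: Cf.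
by apply/funext => x; rewrite big_cons; case: ifP.
Qed.

Lemma partial_coord n (i j : 'I_n) (x : 'cV[R]_n) :
  partial (fun y : 'cV[R]_n => y j 0) i x = (j == i)%:R.
Proof.
apply/cvg_lim => //; apply: cvg_near_cst; near=> h.
rewrite /= !mxE addrK eqxx andbT.
rewrite /GRing.scale /= mulrA mulVf ?mul1r//; near: h; exact: nbhs_dnbhs_neq.
Unshelve. all: by end_near. Qed.

Lemma Ck_coord k n (j : 'I_n) : Ck k (fun y : 'cV[R]_n => y j 0).
Proof.
case: k => [|k]; first exact: coord_continuous.
split=> [x|i]; first exact: differentiable_coord.
rewrite (_ : partial _ i = fun=> (j == i)%:R); first exact: Ck_cst.
by apply/funext => x; exact: partial_coord.
Qed.

Lemma differentiable_col (V : normedModType R) m (g : V -> 'cV[R]_m) x :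
  (forall j, differentiable (fun y => g y j 0) x) -> differentiable g x.
Proof.
move=> dg.
have -> : g = \sum_(j < m) (fun y => g y j 0 *: (delta_mx j 0 : 'cV_m)).
  by apply/funext => y; rewrite fct_sumE [LHS]col_sum_delta.
by apply: differentiable_sum => j; exact: differentiableZl.
Qed.

Lemma partial_comp n m (f : 'cV[R]_m -> R) (g : 'cV[R]_n -> 'cV[R]_m) i x :
  differentiable f (g x) -> (forall j, differentiable (fun y => g y j 0) x) ->
  partial (fun y => f (g y)) i x =
  \sum_j partial f j (g x) * partial (fun y => g y j 0) i x.
Proof.
move=> df dg; have dgx := differentiable_col dg.
rewrite /partial [LHS]deriveE; last exact: differentiable_comp.
rewrite diff_comp //= -(deriveE _ dgx) [X in 'd f _ X]col_sum_delta linear_sum.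
apply: eq_bigr => j _; rewrite linearZ /= -(deriveE _ df).
by rewrite derive_mx ?mxE; [rewrite [LHS]mulrC|exact: diff_derivable].
Qed.

Lemma Ck_comp k n m (f : 'cV[R]_m -> R) (g : 'cV[R]_n -> 'cV[R]_m) :
  Ck k f -> (forall j, Ck k (fun x => g x j 0)) -> Ck k (fun x => f (g x)).
Proof.
elim: k f => [|k IH] f Cf Cg.
  move=> x; apply: (@continuous_comp _ _ _ g f); last exact: Cf.
  by apply: continuous_mxP => i j; rewrite ord1; exact: Cg.
have dg j x : differentiable (fun y => g y j 0) x by exact: (Cg j).1.
split=> [x|i].
  apply: (@differentiable_comp _ _ _ _ g f); last exact: Cf.1.
  exact: differentiable_col.
rewrite (_ : partial _ i = fun x =>
    \sum_j partial f j (g x) * partial (fun y => g y j 0) i x).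
  apply: Ck_sum => j _; apply: CkM; last exact: (Cg j).2.
  by apply: IH => [|l]; [exact: Cf.2|exact/CkW].
by apply/funext => x; apply: partial_comp => //; exact: Cf.1.
Qed.

(** Applying the mean value theorem to the first difference in direction j, and
    then to the partial derivative in direction i. *)
Lemma second_difference n (f : 'cV[R]_n -> R) (i j : 'I_n) (x : 'cV[R]_n) (h : R) :
  Ck 2 f -> exists c d : R, [/\ `|c| <= `|h|, `|d| <= `|h| &
    f (x + h *: delta_mx i 0 + h *: delta_mx j 0) - f (x + h *: delta_mx i 0)
     - (f (x + h *: delta_mx j 0) - f x) =
    h * (h * partial (partial f i) j (x + c *: delta_mx i 0 + d *: delta_mx j 0))].
Proof.
move=> [df Cf].
pose g y := f (y + h *: delta_mx j 0) - f y.
have dsh (y : 'cV[R]_n) : differentiable (fun y => f (y + h *: delta_mx j 0)) y.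
  by apply: (@differentiable_comp _ _ _ _ (shift (h *: delta_mx j 0)) f).
have dg y : differentiable g y by exact: differentiableB.
have pg y : partial g i y = partial f i (y + h *: delta_mx j 0) - partial f i y.
  rewrite /partial [LHS]deriveB; [|exact: diff_derivable..].
  by rewrite derive_translate.
have [|c ch Ec] := @MVT_line R _ g x (delta_mx i 0) h.
  by move=> s; exact: diff_derivable.
have [|d dh Ed] := @MVT_line R _ (partial f i) (x + c *: delta_mx i 0) (delta_mx j 0) h.
  by move=> s; apply/diff_derivable; exact: (Cf i).1.
exists c, d; split=> //.
by rewrite -[LHS]/(g (x + h *: delta_mx i 0) - g x) Ec -[X in h * X]/(partial g i _)
  pg Ed.
Qed.

(** The second difference is symmetric in the two directions, and divided by h^2
    it approximates both mixed derivatives. *)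
Lemma partial_symmetry n (f : 'cV[R]_n -> R) i j x :
  Ck 2 f -> partial (partial f i) j x = partial (partial f j) i x.
Proof.
move=> Cf; have [_ C1] := Cf.
have cont k l : {for x, continuous (partial (partial f k) l)}.
  by have [_ /(_ l)] := C1 k; exact.
apply/eqP/negPn/negP => neq.
pose e := `|partial (partial f i) j x - partial (partial f j) i x| / 2.
have e0 : 0 < e by rewrite divr_gt0// normr_gt0 subr_eq0.
have /cvgrPdist_lt/(_ e e0)/nbhs_ballP[r1 /= r10 H1] := cont i j.
have /cvgrPdist_lt/(_ e e0)/nbhs_ballP[r2 /= r20 H2] := cont j i.
pose h := Num.min r1 r2 / 3.
have m0 : 0 < Num.min r1 r2 by rewrite lt_min r10.
have h0 : 0 < h by rewrite divr_gt0.
have near_x k l (c d : R) : `|c| <= `|h| -> `|d| <= `|h| ->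
    `|x - (x + c *: delta_mx k 0 + d *: (delta_mx l 0 : 'cV[R]_n))|
      < Num.min r1 r2.
  move=> ch dh; rewrite -addrA opprD addrA subrr sub0r normrN.
  have nd (a : 'I_n) : `|delta_mx a 0 : 'cV[R]_n| <= 1.
    apply: norm_le_coord => // u v; rewrite mxE; case: (_ && _) => /=.
      by rewrite normr1.
    by rewrite normr0.
  apply: (@le_lt_trans _ _ (h + h)).
    rewrite (le_trans (ler_normD _ _))// !normrZ.
    rewrite (gtr0_norm h0) in ch dh.
    by apply: lerD; rewrite -[leRHS]mulr1 ler_pM.
  by rewrite -mulr2n -mulr_natl /h mulrCA gtr_pMr// ltr_pdivrMr// mul1r ltr_nat.
have [c [d [ch dh E]]] := @second_difference n f i j x h Cf.
have [c' [d' [ch' dh' E']]] := @second_difference n f j i x h Cf.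
have hn : h != 0 by rewrite gt_eqF.
have key (u v w z u' p p' : R) : u = u' ->
    u - v - (w - z) = h * (h * p) -> u' - w - (v - z) = h * (h * p') -> p = p'.
  move=> <- Ep Ep'; apply: (mulfI hn); apply: (mulfI hn); rewrite -Ep -Ep'.
  by rewrite !opprB addrACA [RHS]addrACA [- w - v]addrC.
have EE := key _ _ _ _ _ _ _ (congr1 f (addrAC _ _ _)) E E'.
have B1 : `|partial (partial f i) j x -
    partial (partial f i) j (x + c *: delta_mx i 0 + d *: delta_mx j 0)| < e.
  apply: H1; rewrite -ball_normE /=; apply: lt_le_trans (near_x _ _ _ _ ch dh) _.
  by rewrite ge_min lexx.
have B2 : `|partial (partial f j) i x -
    partial (partial f j) i (x + c' *: delta_mx j 0 + d' *: delta_mx i 0)| < e.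
  apply: H2; rewrite -ball_normE /=; apply: lt_le_trans (near_x _ _ _ _ ch' dh') _.
  by rewrite ge_min lexx orbT.
have tri (u v p p' : R) : p = p' ->
    `|u - p| < `|u - v| / 2 -> `|v - p'| < `|u - v| / 2 -> False.
  move=> <- up vp; have := ltrD up vp; rewrite -splitr [X in _ + X]distrC.
  by move=> /(le_lt_trans (ler_distD p u v)); rewrite ltxx.
exact: tri EE B1 B2.
Qed.

Lemma smooth_partial m (f : 'cV[R]_m -> R) i : smooth f -> smooth (partial f i).
Proof. by move=> sf I; exact: (sf (i :: I)). Qed.

Lemma bounded_partials_partial m (f : 'cV[R]_m -> R) i :
  bounded_partials 1 f -> bounded_partials 1 (partial f i).
Proof. by move=> bf I _; have := bf (i :: I) isT. Qed.

Lemma smooth_fieldP n m (f : 'cV[R]_n -> 'cV[R]_m) :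
  smooth_field f <-> forall k i, Ck k (fun x => f x i 0).
Proof.
split=> [sf k i|sf i]; first by move: k; apply/smoothP; exact: sf.
by apply/smoothP => k; exact: sf.
Qed.

Lemma Ck_col_mx k n m1 m2 (f : 'cV[R]_n -> 'cV[R]_m1) (g : 'cV[R]_n -> 'cV[R]_m2) :
  (forall i, Ck k (fun x => f x i 0)) -> (forall i, Ck k (fun x => g x i 0)) ->
  forall i, Ck k (fun x => col_mx (f x) (g x) i 0).
Proof.
move=> Cf Cg i.
case E : (fintype.split i) => [j|j].
  rewrite (_ : (fun _ => _) = fun x => f x j 0)//.
  by apply/funext => x; rewrite mxE E.
rewrite (_ : (fun _ => _) = fun x => g x j 0)//.
by apply/funext => x; rewrite mxE E.
Qed.

Lemma derive_partials k (f : 'cV[R]_k -> R) (x v : 'cV[R]_k) :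
  differentiable f x -> 'D_v f x = \sum_j v j 0 * partial f j x.
Proof.
move=> df; rewrite deriveE // [v in LHS]col_sum_delta linear_sum; apply: eq_bigr => j _.
by rewrite linearZ /= -deriveE.
Qed.

(** This gives both the linear growth that makes averages converge and the
    continuity of averages in their parameters. *)
Lemma bounded_partials_lipschitz k (f : 'cV[R]_k -> R) :
  smooth f -> bounded_partials 1 f ->
  exists2 C, 0 <= C & forall u v, `|f u - f v| <= C * \sum_j `|u j 0 - v j 0|.
Proof.
move=> /smoothP sf bf.
have bf1 (i : 'I_k) : {C : R | forall x, `|partial f i x| <= C}.
  by apply: cid; exact: (bf [:: i]).
pose C := \sum_i sval (bf1 i).
have C0 i : 0 <= sval (bf1 i).
  by apply: le_trans (svalP (bf1 i) 0).
exists C; first by apply: sumr_ge0.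
have df : forall x, differentiable f x by have [] := sf 1.
move=> u v.
have [|c _] := @MVT_line R _ f v (u - v) 1.
  by move=> s; exact: diff_derivable.
rewrite scale1r [v + _]addrC subrK mul1r => ->; rewrite derive_partials//.
rewrite (le_trans (ler_norm_sum _ _ _))// mulr_sumr; apply: ler_sum => j _.
rewrite normrM !mxE mulrC ler_wpM2r// (le_trans (svalP (bf1 j) _))//.
by rewrite /C (bigD1 j) //= lerDl sumr_ge0.
Qed.

End smoothness.

(** * Differentiating averages in their parameters *)

Section measurability.
Context {R : realType} d (Y : measurableType d).

(** The coordinates are rounded down to a grid of mesh 1/(n+1): the rounded
    functions take countably many values, hence are measurable, and they converge
    by continuity. *)
Lemma measurable_continuous_comp m (f : 'cV[R]_m -> R) (X : Y -> 'cV[R]_m) :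
  continuous f -> (forall i, measurable_fun setT (fun z => X z i 0)) ->
  measurable_fun setT (fun z => f (X z)).
Proof.
move=> cf mX.
pose grid n (t : 'cV[int]_m) : 'cV[R]_m := \col_i ((t i 0)%:~R / n.+1%:R).
pose rd n z : 'cV[int]_m := \col_i Num.floor (n.+1%:R * X z i 0).
apply: (@measurable_fun_cvg _ _ _ _ (fun n z => f (grid n (rd n z)))).
  move=> n _ B mB; rewrite setTI.
  rewrite (_ : _ @^-1` B = \bigcup_(t : 'cV[int]_m)
     (if f (grid n t) \in B then
       \big[setI/setT]_(i < m) [set z | Num.floor (n.+1%:R * X z i 0) = t i 0]
      else set0)); last first.
    apply/seteqP; split => [z Bz|z [t _]].
      exists (rd n z) => //; rewrite ifT ?inE// -bigcap_seq.
      by move=> i _ /=; rewrite mxE.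
    case: ifPn => [|_ []]; rewrite inE /= => Bt.
    rewrite -bigcap_seq => zt.
    suff -> : rd n z = t by [].
    by apply/colP => i; rewrite mxE -(zt i) //= mem_index_enum.
  apply: countable_bigcupT_measurable => [|t]; first exact: countableP.
  case: ifP => // _.
  apply: bigsetI_measurable => i _.
  rewrite (_ : [set _ | _] = (fun z => n.+1%:R * X z i 0) @^-1`
     `[(t i 0)%:~R, (t i 0 + 1)%:~R[); last first.
    apply/seteqP; split => z /=; rewrite in_itv /=.
      by move=> <-; exact: floor_itv.
    by move=> /floor_def.
  rewrite -[X in measurable X]setTI.
  by apply: measurable_funM => //; exact: mX.
move=> z _; suff C : grid n (rd n z) @[n --> \oo] --> X z.
  exact: (cvg_comp _ _ C (cf (X z))).
apply/cvgrPdist_le => /= e e0; near=> n; apply: norm_le_coord; first exact: ltW.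
move=> i j; rewrite !mxE ord1.
have n0 : 0 < n.+1%:R :> R by rewrite ltr0n.
have /andP[l1 l2] := floor_itv (n.+1%:R * X z i 0).
have -> : X z i 0 - (Num.floor (n.+1%:R * X z i 0))%:~R / n.+1%:R =
  (n.+1%:R * X z i 0 - (Num.floor (n.+1%:R * X z i 0))%:~R) / n.+1%:R.
  by rewrite mulrBl mulrAC mulfV ?mul1r// gt_eqF.
rewrite normrM ger0_norm ?subr_ge0// ger0_norm ?invr_ge0 ?(ltW n0)//.
apply: (@le_trans _ _ n.+1%:R^-1).
  rewrite ler_piMl ?invr_ge0 ?(ltW n0)// lerBlDr.
  by move: l2; rewrite intrD addrC => /ltW.
by apply: ltW; near: n; exact: near_infty_natSinv_lt (PosNum e0).
Unshelve. all: by end_near. Qed.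

End measurability.

(** The averages of f are integrals of f (T z x) against weights w z, in which the
    evaluation point is linear in the parameter x. *)
Section parametric_integral.
Context {R : realType} d (Y : measurableType d) (mu : {measure set Y -> \bar R}).
Context (m n : nat) (T : Y -> 'M[R]_(m, n)) (W : set (Y -> R)).
Hypothesis mT : forall i c, measurable_fun setT (fun z => T z i c).
Hypothesis W_T : forall w, W w -> forall i c, W (fun z => T z i c * w z).
Hypothesis W_int : forall w, W w -> mu.-integrable setT (EFin \o w).

Let mW w : W w -> measurable_fun setT w.
Proof. by move=> /W_int /integrableP[/measurable_EFinP]. Qed.

Definition weighted_average (f : 'cV[R]_m -> R) (w : Y -> R) (x : 'cV[R]_n) : R :=
  \int[mu]_z (f (T z *m x) * w z).

Lemma integrable_normr_sum (w : Y -> R) (c : 'I_m -> 'I_n -> R) (C : R) : W w ->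
  mu.-integrable setT
   (EFin \o (fun z => C * \sum_i \sum_j (c i j * `|T z i j * w z|))).
Proof.
move=> Ww; rewrite /comp; under eq_fun do rewrite EFinM.
apply: integrableZl => //; under eq_fun do rewrite -sumEFin.
apply: integrable_sum => // i _; under eq_fun do rewrite -sumEFin.
apply: integrable_sum => // j _; under eq_fun do rewrite EFinM.
apply: integrableZl => //.
exact: (integrable_norm (W_int (W_T Ww i j))).
Qed.

Lemma weighted_lipschitz (f : 'cV[R]_m -> R) (w : Y -> R) (C : R) x y z :
  0 <= C ->
  (forall u v, `|f u - f v| <= C * \sum_j `|u j 0 - v j 0|) ->
  `|f (T z *m x) * w z - f (T z *m y) * w z| <=
   C * \sum_i \sum_j (`|x j 0 - y j 0| * `|T z i j * w z|).
Proof.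
move=> C0 Cf; rewrite -mulrBl normrM.
apply: (@le_trans _ _ ((C * \sum_i `|(T z *m x) i 0 - (T z *m y) i 0|) * `|w z|)).
  by rewrite ler_wpM2r.
rewrite -mulrA ler_wpM2l// mulr_suml; apply: ler_sum => i _.
rewrite !mxE -sumrB -normrM mulr_suml (le_trans (ler_norm_sum _ _ _))//.
apply: ler_sum => j _.
by rewrite -mulrBr !normrM mulrCA mulrA.
Qed.

Section fixed_function.
Context (f : 'cV[R]_m -> R) (w : Y -> R).
Hypotheses (sf : smooth f) (bf : bounded_partials 1 f) (Ww : W w).

Lemma weighted_measurable x : measurable_fun setT (fun z => f (T z *m x) * w z).
Proof.
apply: measurable_funM; last exact: mW.
apply: measurable_continuous_comp; first exact: (sf [::]).1.
move=> i; rewrite (_ : (fun _ => _) = fun z => \sum_j T z i j * x j 0).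
  by apply: measurable_sum => j; exact: measurable_funM.
by apply/funext => z; rewrite mxE.
Qed.

Lemma weighted_integrable x :
  mu.-integrable setT (EFin \o (fun z => f (T z *m x) * w z)).
Proof.
have [C C0 Cf] := bounded_partials_lipschitz sf bf.
pose g z := C * \sum_i \sum_j (`|x j 0 - (0 : 'cV[R]_n) j 0| * `|T z i j * w z|)
   + `|f 0| * `|w z|.
pose h1 := EFin \o (fun z => C *
   \sum_i \sum_j (`|x j 0 - (0 : 'cV[R]_n) j 0| * `|T z i j * w z|)).
pose h2 z := (`|f 0|%:E * `|(w z)%:E|)%E.
apply: (@le_integrable _ _ _ mu _ measurableT _ (EFin \o g)).
- by apply/measurable_EFinP; exact: weighted_measurable.
- move=> z _ /=; rewrite lee_fin [leRHS]ger0_norm; last first.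
    apply: addr_ge0; last exact: mulr_ge0.
    by apply: mulr_ge0 => //; do 2!apply: sumr_ge0 => ? _; exact: mulr_ge0.
  rewrite -[X in `|X|](subrK (f (T z *m 0) * w z)) (le_trans (ler_normD _ _))//.
  by rewrite lerD ?weighted_lipschitz// mulmx0 normrM.
- rewrite (_ : EFin \o g = (h1 \+ h2)%E) //.
  apply: integrableD => //; first exact: integrable_normr_sum.
  by apply: integrableZl => //; exact: (integrable_norm (W_int Ww)).
Qed.

Lemma weighted_average_continuous : continuous (weighted_average f w).
Proof.
have [C C0 Cf] := bounded_partials_lipschitz sf bf.
pose N z := \sum_i \sum_j (1 * `|T z i j * w z|).
have iN : mu.-integrable setT (EFin \o (fun z => 1 * N z)).
  exact: (@integrable_normr_sum w (fun _ _ => 1) 1).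
pose I := \int[mu]_z (1 * N z).
have I0 : 0 <= I.
  apply: Rintegral_ge0 => z _; rewrite mul1r.
  by do 2!apply: sumr_ge0 => ? _; rewrite mul1r.
have lip x y : `|weighted_average f w x - weighted_average f w y|
    <= C * `|x - y| * I.
  rewrite /weighted_average -RintegralB//; try exact: weighted_integrable.
  pose h z := f (T z *m x) * w z - f (T z *m y) * w z.
  have ih : mu.-integrable setT (EFin \o h).
    pose u v := EFin \o (fun z => f (T z *m v) * w z).
    rewrite (_ : EFin \o h = (u x \- u y)%E)//.
    by apply: integrableB => //; exact: weighted_integrable.
  apply: (@le_trans _ _ (\int[mu]_z `|h z|)); first exact: le_normr_Rintegral.
  rewrite /I -RintegralZl//; apply: le_Rintegral => //.
  - exact: (integrable_norm ih).
  - rewrite (_ : EFin \o _ = fun z => ((C * `|x - y|)%:E * (1 * N z)%:E)%E)//.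
    exact: integrableZl.
  move=> z _; apply: le_trans (weighted_lipschitz _ _ _ _ C0 Cf) _.
  rewrite mul1r -mulrA ler_wpM2l// /N mulr_sumr; apply: ler_sum => i _.
  rewrite mulr_sumr; apply: ler_sum => j _; rewrite mul1r ler_wpM2r//.
  by have := coord_le_norm (x - y) j 0; rewrite !mxE.
move=> x; apply/(@cvgrPdist_le _ R^o _ (nbhs x)) => e e0.
have D0 : 0 < C * I + 1 by rewrite ltr_wpDl// mulr_ge0.
have ed : 0 < (C * I + 1)^-1 * e by rewrite mulr_gt0// invr_gt0.
have B : \forall y \near x, `|x - y| <= (C * I + 1)^-1 * e.
  apply/nbhs_ballP; exists ((C * I + 1)^-1 * e) => //= y.
  by rewrite -ball_normE /= => /ltW.
apply: filterS B => y xy; apply: le_trans (lip _ _) _.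
rewrite mulrAC; apply: (@le_trans _ _ ((C * I + 1) * `|x - y|)).
  by rewrite ler_wpM2r// lerDl.
by rewrite -ler_pdivlMl.
Qed.

End fixed_function.

Lemma Rintegral_sum I (r : seq I) (h : I -> Y -> R) :
  (forall i, mu.-integrable setT (EFin \o h i)) ->
  \int[mu]_z (\sum_(i <- r) h i z) = \sum_(i <- r) \int[mu]_z h i z.
Proof.
move=> ih; elim: r => [|i r IH].
  rewrite big_nil; under eq_Rintegral do rewrite big_nil.
  by rewrite Rintegral_cst// mul0r.
under eq_Rintegral do rewrite big_cons.
rewrite big_cons -IH -RintegralD//.
rewrite /comp; under eq_fun do rewrite -sumEFin.
by apply: integrable_sum => // j _; exact: ih.
Qed.

Lemma weighted_average_is_derive (f : 'cV[R]_m -> R) (w : Y -> R) x c :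
  smooth f -> bounded_partials 1 f -> W w ->
  is_derive x (delta_mx c 0 : 'cV[R]_n) (weighted_average f w)
    (\sum_i weighted_average (partial f i) (fun z => T z i c * w z) x).
Proof.
move=> sf bf Ww.
have Cf1 : Ck 1 f by have /smoothP := sf; exact.
have bf1 (i : 'I_m) : {C : R | forall x, `|partial f i x| <= C}.
  by apply: cid; exact: (bf [:: i]).
pose C := \sum_i sval (bf1 i).
have C0 i : 0 <= sval (bf1 i).
  by apply: le_trans (svalP (bf1 i) 0).
have leC i y : `|partial f i y| <= C.
  by rewrite (le_trans (svalP (bf1 i) _))// /C (bigD1 i) //= lerDl sumr_ge0.
pose e : 'cV[R]_n := delta_mx c 0.
pose phi (t : R) z := f (T z *m (x + t *: e)) * w z.
have dphi t z : is_derive t (1 : R) (phi ^~ z)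
    (\sum_i (partial f i (T z *m (x + t *: e)) * (T z i c * w z))).
  have E : (fun t => f (T z *m (x + t *: e))) =
           (fun t => f (T z *m x + t *: (T z *m e))).
    by apply/funext => s; rewrite mulmxDr -scalemxAr.
  have D : is_derive t (1 : R) (fun t => f (T z *m (x + t *: e)))
      ('D_(T z *m e) f (T z *m (x + t *: e))).
    rewrite E mulmxDr -scalemxAr; apply: is_derive_line.
    by apply: diff_derivable; exact: Cf1.1.
  rewrite (_ : \sum_i _ = w z *: 'D_(T z *m e) f (T z *m (x + t *: e))).
    rewrite (_ : phi ^~ z = w z \*: (fun t => f (T z *m (x + t *: e)))).
      exact: is_deriveZ.
    by apply/funext => s; rewrite /phi mulrC.
  rewrite derive_partials; last exact: Cf1.1.
  rewrite scaler_sumr; apply: eq_bigr => i _.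
  by rewrite /e -colE mxE [LHS]mulrC -mulrA mulrCA.
have iphi t : mu.-integrable setT (EFin \o phi t).
  exact: weighted_integrable.
pose G z := C * \sum_i \sum_j ((j == c)%:R * `|T z i j * w z|).
have G0 z : 0 <= G z.
  apply: mulr_ge0; first exact: sumr_ge0.
  by do 2!apply: sumr_ge0 => ? _; exact: mulr_ge0.
have iG : mu.-integrable setT (EFin \o G) by exact: integrable_normr_sum.
have uG t z : `|partial1of2 phi t z| <= G z.
  rewrite partial1of2E derive_val (le_trans (ler_norm_sum _ _ _))// /G mulr_sumr.
  apply: ler_sum => i _; rewrite normrM ler_pM//.
  by rewrite (bigD1 c) //= eqxx mul1r lerDl sumr_ge0// => ? _; rewrite mulr_ge0.
have I0 : (`]-1, 1[%classic : set R) 0 by rewrite /= in_itv /= ltrN10 ltr01.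
have dF := @derivable_under_integral R _ Y mu phi setT measurableT 0 (-1) 1 I0
  (fun t _ => iphi t) (fun t z _ _ => @ex_derive _ _ _ _ _ _ _ (dphi t z)) G G0 iG
  (fun t z _ _ => uG t z).
have vF := @differentiation_under_integral R _ Y mu phi setT measurableT 0 (-1) 1 I0
  (fun t _ => iphi t) (fun t z _ _ => @ex_derive _ _ _ _ _ _ _ (dphi t z)) G G0 iG
  (fun t z _ _ => uG t z).
have E : (fun t : R => \int[mu]_z phi t z) =
         (fun t => weighted_average f w (t *: e + x)).
  by apply/funext => t; apply: eq_Rintegral => z _; rewrite /phi [x + _]addrC.
rewrite E in dF vF.
have dx : derivable (weighted_average f w) x e by apply/derivable1P.
split=> //; transitivity (derive1 (fun t : R => weighted_average f w (t *: e + x)) 0).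
  by rewrite derive1E -derive_line0.
rewrite vF -Rintegral_sum; last first.
  move=> i; apply: weighted_integrable; [exact: smooth_partial
    |exact: bounded_partials_partial|exact: W_T].
apply: eq_Rintegral => z _; rewrite partial1of2E derive_val.
by apply: eq_bigr => i _; rewrite scale0r addr0.
Qed.

(** Each derivative in x multiplies the weight by an entry of T; this is why the
    weights range over a class stable under these multiplications. *)
Lemma weighted_average_smooth (f : 'cV[R]_m -> R) (w : Y -> R) :
  smooth f -> bounded_partials 1 f -> W w -> smooth (weighted_average f w).
Proof.
move=> sf bf Ww; apply/smoothP => k.
elim: k f w sf bf Ww => [|k IH] f w sf bf Ww.
  exact: weighted_average_continuous.
have dx x c := weighted_average_is_derive x c sf bf Ww.
have pE c : partial (weighted_average f w) c = fun x =>
    \sum_i weighted_average (partial f i) (fun z => T z i c * w z) x.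
  by apply/funext => x; exact: (@derive_val _ _ _ _ _ _ _ (dx x c)).
have Cp c : Ck k (partial (weighted_average f w) c).
  rewrite pE; apply: Ck_sum => i _; apply: IH; [exact: smooth_partial
    |exact: bounded_partials_partial|exact: W_T].
split=> // x; apply: differentiable_partials => [y c|c].
  exact: (@ex_derive _ _ _ _ _ _ _ (dx y c)).
exact: (Ck_continuous (Cp c)).
Qed.

End parametric_integral.

(** * Gaussian averages and the averaged potential *)

Section gaussian_weights.
Context {R : realType}.
Local Notation mR := (measurableTypeR R).

Lemma integrable_mul_prod d1 d2 (T1 : measurableType d1) (T2 : measurableType d2)
    (m1 : {sigma_finite_measure set T1 -> \bar R})
    (m2 : {sigma_finite_measure set T2 -> \bar R}) (u : T1 -> R) (v : T2 -> R) :
  m1.-integrable setT (EFin \o u) -> m2.-integrable setT (EFin \o v) ->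
  (m1 \x m2)%E.-integrable setT (EFin \o (fun z => u z.1 * v z.2)).
Proof.
move=> iu iv.
have mu : measurable_fun setT u by case/integrableP: iu => /measurable_EFinP.
have mv : measurable_fun setT v by case/integrableP: iv => /measurable_EFinP.
apply/integrable12ltyP.
  apply/measurable_EFinP/measurable_funM; exact: measurableT_comp.
have [_ iu'] := integrableP _ _ _ iu; have [_ iv'] := integrableP _ _ _ iv.
under eq_integral => x _.
  under eq_integral do rewrite /= normrM EFinM.
  rewrite ge0_integralZl//=; last first.
    by do 2!apply: measurableT_comp => //.
  over.
rewrite ge0_integralZr//=.
- by apply: lte_mul_pinfty => //; [exact: integral_ge0|rewrite ge0_fin_numE//; exact: integral_ge0].
- by do 2!apply: measurableT_comp => //.
- exact: integral_ge0.
Qed.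

Definition gauss_tuple n (z : n.-tuple mR) : R :=
  expR (- (1 / 8 * sqnorm (col_of_tuple z))).

Lemma integrable_gauss_line :
  (@lebesgue_measure R).-integrable setT
    (EFin \o (fun x : R => expR (- (1 / 8 * x ^+ 2)))).
Proof.
have s0 : (2 : R) != 0 by rewrite pnatr_eq0.
have p0 := normal_peak_gt0 s0.
rewrite (_ : _ \o _ = fun x => ((normal_peak 2)^-1%:E * (normal_pdf 0 2 x)%:E)%E).
  by apply: integrableZl => //; exact: integrable_normal_pdf.
apply/funext => x /=; rewrite -EFinM /normal_pdf (negbTE s0) mulKf ?gt_eqF//.
congr (expR _)%:E; rewrite subr0 mul1r mulNr mulrC; congr (- (_ * _^-1)).
by rewrite -natrX -mulrnA.
Qed.

(** The weight is a product of one-dimensional ones, and integrates by Tonelli's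
    theorem, one coordinate at a time. *)
Lemma integrable_gauss_tuple n :
  (lebesgue_tuple R n).-integrable setT (EFin \o @gauss_tuple n).
Proof.
have mg k : measurable_fun setT (@gauss_tuple k).
  apply: measurableT_comp => //; apply: measurableT_comp => //.
  apply: measurable_funM => //; apply: measurable_sum => i.
  apply: measurable_funX; rewrite (_ : (fun _ => _) = @tnth _ mR ^~ i).
    exact: measurable_tnth.
  by apply/funext => z; rewrite mxE.
elim: n => [|n IH] /=.
  apply/integrableP; split; first by apply/measurable_EFinP; exact: mg.
  rewrite integral_dirac//; last first.
    by apply: measurableT_comp => //; apply/measurable_EFinP; exact: mg.
  by rewrite /= diracE mem_set// mul1e ltry.
have mc := @measurable_tuple_cons R n.
pose m := (@lebesgue_measure R \x lebesgue_tuple R n)%E.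
have mge : measurable_fun setT (EFin \o @gauss_tuple n.+1).
  by apply/measurable_EFinP; exact: mg.
apply/integrableP; split=> //.
rewrite -[X in (X < _)%E]/(\int[pushforward m (@tuple_cons R n)]_z
  `|(gauss_tuple z)%:E|)%E ge0_integral_pushforward//; last first.
  exact: measurableT_comp.
suff /integrableP[_] : m.-integrable setT ((EFin \o @gauss_tuple n.+1) \o @tuple_cons R n).
  by rewrite preimage_setT.
rewrite (_ : _ \o _ =
   EFin \o (fun z => expR (- (1 / 8 * z.1 ^+ 2)) * gauss_tuple z.2)).
  exact: integrable_mul_prod integrable_gauss_line IH.
apply/funext => -[x z] /=; congr EFin; rewrite /gauss_tuple -expRD; congr expR.
rewrite -opprD -mulrDr; congr (- (_ * _)); rewrite /sqnorm big_ord_recl !mxE tnth0.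
by congr (_ + _); apply: eq_bigr => i _; rewrite !mxE tnthS.
Qed.

Context (d : nat).
Local Notation Y := (d.-tuple mR * d.-tuple mR)%type.

Definition sqnorm2 (z : Y) : R :=
  sqnorm (col_of_tuple z.1) + sqnorm (col_of_tuple z.2).

(** Decay at every Gaussian rate below 1/2: the strict inequality leaves room for
    multiplication by any polynomial. *)
Definition gauss_weight : set (Y -> R) := [set w : Y -> R |
  measurable_fun setT w /\
  forall c, c < 1 / 2 -> exists C, forall z, `|w z| <= C * expR (- (c * sqnorm2 z))].

Lemma sqnorm_ge0 n (v : 'cV[R]_n) : 0 <= sqnorm v.
Proof. by apply: sumr_ge0 => i _; exact: sqr_ge0. Qed.

Lemma sqnorm2_ge0 z : 0 <= sqnorm2 z.
Proof. by rewrite addr_ge0 ?sqnorm_ge0. Qed.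

Lemma gauss_weight_integrable w : gauss_weight w ->
  (lebesgue_tuple R d \x lebesgue_tuple R d)%E.-integrable setT (EFin \o w).
Proof.
move=> [mw /(_ (1 / 8))[]].
  by rewrite ltr_pM2l// ltf_pV2 ?posrE// ltr_nat.
move=> C wC.
pose g (z : Y) := gauss_tuple z.1 * gauss_tuple z.2.
apply: (@le_integrable _ _ _ _ _ measurableT _ (fun z => (C%:E * (g z)%:E)%E)).
- exact/measurable_EFinP.
- move=> z _; rewrite -EFinM lee_fin (le_trans (wC z))// (le_trans _ (ler_norm _))//.
  by rewrite /g /gauss_tuple -expRD -opprD -mulrDr.
- apply: integrableZl => //.
  exact: integrable_mul_prod (integrable_gauss_tuple d) (integrable_gauss_tuple d).
Qed.

(** The weight decays at the rate midway between c and 1/2, and the surplus of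
    this rate over c absorbs the factor 1 + |z|^2. *)
Lemma gauss_weight_mul (p w : Y -> R) (K : R) :
  measurable_fun setT p -> (forall z, `|p z| <= K * (1 + sqnorm2 z)) ->
  gauss_weight w -> gauss_weight (fun z => p z * w z).
Proof.
move=> mp pK [mw wC]; split; first exact: measurable_funM.
move=> c c2.
pose c' := (c + 1 / 2) / 2; pose e := c' - c.
have c'2 : c' < 1 / 2 by rewrite midf_lt.
have e0 : 0 < e by rewrite subr_gt0 midf_lt.
have [C Cw] := wC _ c'2.
exists (`|K| * (1 + e^-1) * C) => z.
have S0 := sqnorm2_ge0 z.
have P : `|p z| <= `|K| * (1 + e^-1) * expR (e * sqnorm2 z).
  apply: le_trans (pK z) _.
  apply: (@le_trans _ _ (`|K| * (1 + sqnorm2 z))).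
    by rewrite ler_wpM2r ?ler_norm// addr_ge0.
  rewrite -mulrA ler_wpM2l//.
  apply: (@le_trans _ _ ((1 + e^-1) * (1 + e * sqnorm2 z))).
    have -> : (1 + e^-1) * (1 + e * sqnorm2 z) =
        1 + sqnorm2 z + (e * sqnorm2 z + e^-1) by field; rewrite gt_eqF.
    by rewrite lerDl addr_ge0 ?invr_ge0 ?mulr_ge0// ltW.
  by rewrite ler_wpM2l ?expR_ge1Dx// addr_ge0// invr_ge0 ltW.
rewrite normrM (le_trans (ler_pM _ _ P (Cw z)))//.
rewrite mulrACA -expRD (_ : e * _ + _ = - (c * sqnorm2 z))//.
by rewrite /e mulrBl addrAC subrr sub0r.
Qed.

End gaussian_weights.

Section averaged_potential.
Context {R : realType}.
Local Notation mR := (measurableTypeR R).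

Section shift.
Context (d : nat).
Local Notation Y := (d.-tuple mR * d.-tuple mR)%type.

(** The evaluation point of the average, as a linear function of the
    parameters. *)
Definition shift_mx (z : Y) : 'M[R]_(d, dimD d) :=
  \matrix_(i, c) (pos (delta_mx c 0 : 'cV[R]_(dimD d))
    + wid1 (delta_mx c 0 : 'cV[R]_(dimD d)) *m col_of_tuple z.1
    + wid2 (delta_mx c 0 : 'cV[R]_(dimD d)) *m col_of_tuple z.2) i 0.

Lemma shift_mxE z (x : 'cV[R]_(dimD d)) : shift_mx z *m x =
  pos x + wid1 x *m col_of_tuple z.1 + wid2 x *m col_of_tuple z.2.
Proof.
pose f (x : 'cV[R]_(dimD d)) :=
  pos x + wid1 x *m col_of_tuple z.1 + wid2 x *m col_of_tuple z.2.
have lf : linear f.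
  move=> k a b; rewrite /f /pos /wid1 /wid2 /unvec !linearP /=.
  rewrite !mulmxDl -!scalemxAl !scalerDr.
  have AC (u1 u2 v1 v2 w1 w2 : 'cV[R]_d) :
    u1 + u2 + (v1 + v2) + (w1 + w2) = u1 + v1 + w1 + (u2 + v2 + w2).
    by rewrite (addrACA u1 u2) (addrACA (u1 + v1)).
  exact: AC.
pose fL : {linear 'cV[R]_(dimD d) -> 'cV[R]_d} :=
  HB.pack f (GRing.isLinear.Build _ _ _ _ f lf).
rewrite -[RHS]/(fL x) [in RHS](col_sum_delta x) linear_sum.
apply/colP => i; rewrite mxE summxE; apply: eq_bigr => j _.
by rewrite linearZ [RHS]mxE mulrC; congr (_ * _); rewrite [LHS]mxE.
Qed.

Lemma shift_mx_measurable i c : measurable_fun setT (fun z => shift_mx z i c).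
Proof.
rewrite (_ : (fun _ => _) = fun z : Y => pos (delta_mx c 0 : 'cV[R]_(dimD d)) i 0 +
   \sum_j wid1 (delta_mx c 0 : 'cV[R]_(dimD d)) i j * tnth z.1 j +
   \sum_j wid2 (delta_mx c 0 : 'cV[R]_(dimD d)) i j * tnth z.2 j); last first.
  apply/funext => z; rewrite mxE [LHS]mxE; congr (_ + _).
    rewrite mxE; congr (_ + _); rewrite mxE; apply: eq_bigr => j _.
    by rewrite [X in _ * X]mxE.
  by rewrite mxE; apply: eq_bigr => j _; rewrite [X in _ * X]mxE.
apply: measurable_funD; first apply: measurable_funD => //.
  apply: measurable_sum => j; apply: measurable_funM => //.
  by apply: (measurableT_comp (measurable_tnth j)).
apply: measurable_sum => j; apply: measurable_funM => //.
by apply: (measurableT_comp (measurable_tnth j)).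
Qed.

Lemma shift_mx_le i c : exists K, forall z, `|shift_mx z i c| <= K * (1 + sqnorm2 z).
Proof.
pose p : R := `|pos (delta_mx c 0 : 'cV[R]_(dimD d)) i 0|.
pose a j : R := `|wid1 (delta_mx c 0 : 'cV[R]_(dimD d)) i j|.
pose b j : R := `|wid2 (delta_mx c 0 : 'cV[R]_(dimD d)) i j|.
exists (p + \sum_j a j + \sum_j b j) => z.
have coord n (t : n.-tuple mR) j : `|col_of_tuple t j 0| <= 1 + sqnorm (col_of_tuple t).
  have h : `|col_of_tuple t j 0| <= 1 + col_of_tuple t j 0 ^+ 2.
    by rewrite ler_norml; apply/andP; split; nra.
  apply: le_trans h _; rewrite lerD2l /sqnorm (bigD1 j) //= lerDl.
  by apply: sumr_ge0 => k _; exact: sqr_ge0.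
have S1 : 1 + sqnorm (col_of_tuple z.1) <= 1 + sqnorm2 z.
  by rewrite lerD2l lerDl sqnorm_ge0.
have S2 : 1 + sqnorm (col_of_tuple z.2) <= 1 + sqnorm2 z.
  by rewrite lerD2l lerDr sqnorm_ge0.
have S0 : 0 <= sqnorm2 z := sqnorm2_ge0 z.
rewrite mxE [X in `|X|]mxE !mulrDl (le_trans (ler_normD _ _))// lerD//.
  rewrite mxE (le_trans (ler_normD _ _))// lerD//.
    by rewrite /p ler_peMr// lerDl.
  rewrite mxE (le_trans (ler_norm_sum _ _ _))// mulr_suml; apply: ler_sum => j _.
  by rewrite normrM /a ler_wpM2l// (le_trans (coord _ _ _)).
rewrite mxE (le_trans (ler_norm_sum _ _ _))// mulr_suml; apply: ler_sum => j _.
by rewrite normrM /b ler_wpM2l// (le_trans (coord _ _ _)).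
Qed.

Lemma gauss_density_weight : gauss_weight (fun z : Y => expR (- (1 / 2 * sqnorm2 z))).
Proof.
split; last first.
  move=> c c2; exists 1 => z; rewrite [leRHS]mul1r ger0_norm ?expR_ge0// ler_expR lerN2.
  by rewrite ler_wpM2r ?sqnorm2_ge0// ltW.
apply: measurableT_comp => //; apply: measurableT_comp => //.
apply: measurable_funM => //.
apply: measurable_funD; apply: measurable_sum => i; apply: measurable_funX.
  rewrite (_ : (fun _ => _) = fun z : Y => tnth z.1 i).
    by apply: (measurableT_comp (measurable_tnth i)).
  by apply/funext => z; rewrite mxE.
rewrite (_ : (fun _ => _) = fun z : Y => tnth z.2 i).
  by apply: (measurableT_comp (measurable_tnth i)).
by apply/funext => z; rewrite mxE.
Qed.

Lemma avg_smooth (f : 'cV[R]_d -> R) :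
  smooth f -> bounded_partials 1 f -> smooth (avg f).
Proof.
move=> sf bf.
pose mu : {measure set Y -> \bar R} := (lebesgue_tuple R d \x lebesgue_tuple R d)%E.
have WT (w : Y -> R) : gauss_weight w ->
    forall i c, gauss_weight (fun z => shift_mx z i c * w z).
  move=> Ww i c; have [K hK] := shift_mx_le i c.
  exact: gauss_weight_mul (shift_mx_measurable i c) hK Ww.
have /smoothP s := @weighted_average_smooth _ _ _ mu _ _ shift_mx (@gauss_weight R d)
  shift_mx_measurable WT (@gauss_weight_integrable R d) _ _ sf bf
  gauss_density_weight.
apply/smoothP => k.
rewrite (_ : avg f = fun x => ((2 * pi) ^+ d)^-1 *
  weighted_average mu shift_mx f (fun z : Y => expR (- (1 / 2 * sqnorm2 z))) x).
  exact/CkZ.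
apply/funext => x; rewrite /avg; congr (_ * _).
by apply: eq_Rintegral => z _; rewrite shift_mxE mulNr.
Qed.

End shift.

Lemma Ck_mul_vec k n d (F G : 'cV[R]_n -> 'M[R]_d) :
  (forall i j, Ck k (fun x => F x i j)) -> (forall i j, Ck k (fun x => G x i j)) ->
  forall i, Ck k (fun x => vec (F x *m G x) i 0).
Proof.
move=> CF CG i; case/mxvec_indexP: i => a b.
rewrite (_ : (fun _ => _) = fun x => \sum_l F x b l * G x l a).
  by apply: Ck_sum => l _; exact: CkM.
by apply/funext => x; rewrite /vec mxE mxvecE !mxE.
Qed.

Theorem avg_potential_smooth d (A : 'cV[R]_d -> 'cV[R]_d) :
  smooth_field A -> (forall i, bounded_partials 1 (fun x => A x i 0)) ->
  smooth_field (avg_potential A).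
Proof.
move=> sA bA.
have CJ k i j : Ck k (fun x => avg_mx (jacobi A) x i j).
  rewrite (_ : (fun _ => _) = avg (partial (fun y => A y i 0) j)).
    move: k; apply/smoothP/avg_smooth; first exact/smooth_partial/sA.
    exact: bounded_partials_partial.
  apply/funext => x; rewrite mxE; congr avg.
  by apply/funext => y; rewrite mxE.
apply/smooth_fieldP => k; rewrite /avg_potential; apply: Ck_col_mx => [i|].
  rewrite (_ : (fun _ => _) = avg (fun y => A y i 0)).
    by move: k; apply/smoothP; exact: avg_smooth.
  by apply/funext => x; rewrite mxE.
apply: Ck_col_mx; apply: Ck_mul_vec => // i j.
  rewrite (_ : (fun _ => _) = fun x : 'cV[R]_(dimD d) =>
     x (rshift d (lshift (d * d) (mxvec_index j i))) 0); first exact: Ck_coord.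
  by apply/funext => x; rewrite !mxE.
rewrite (_ : (fun _ => _) = fun x : 'cV[R]_(dimD d) =>
   x (rshift d (rshift (d * d) (mxvec_index j i))) 0); first exact: Ck_coord.
by apply/funext => x; rewrite !mxE.
Qed.

End averaged_potential.

(** * Ordinary differential equations *)

Section ordinary_differential_equations.
Context {R : realType}.

Lemma is_derive_coord m (y : R -> 'cV[R]_m) t dy i :
  is_derive t (1 : R) y dy -> is_derive t (1 : R) (fun s => y s i 0) (dy i 0).
Proof.
move=> [ey <-]; have ec := (derivable_mxP y t (1 : R)).1 ey.
split; first exact: ec.
by rewrite derive_mx// mxE.
Qed.

Lemma is_derive_col m (y : R -> 'cV[R]_m) t (dy : 'cV[R]_m) :
  (forall i, is_derive t (1 : R) (fun s => y s i 0) (dy i 0)) ->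
  is_derive t (1 : R) y dy.
Proof.
move=> H; have ey : derivable y t 1.
  by apply/derivable_mxP => i j; rewrite ord1; exact: (@ex_derive _ _ _ _ _ _ _ (H i)).
split=> //; rewrite derive_mx//; apply/matrixP => i j.
by rewrite !mxE ord1; exact: (@derive_val _ _ _ _ _ _ _ (H i)).
Qed.

Lemma is_derive_continuous (V : normedModType R) (y : R -> V) (t : R) dy :
  is_derive t (1 : R) y dy -> {for t, continuous y}.
Proof.
by move=> [ey _]; apply/differentiable_continuous/derivable1_diffP.
Qed.

Lemma mean_value_bound m (y dy : R -> 'cV[R]_m) (a b M : R) :
  a <= b -> 0 <= M ->
  (forall t, a <= t <= b -> is_derive t (1 : R) y (dy t)) ->
  (forall t, a < t < b -> `|dy t| <= M) -> `|y b - y a| <= M * (b - a).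
Proof.
move=> ab M0 Hy HM.
apply: norm_le_coord => [|i j]; first by rewrite mulr_ge0// subr_ge0.
rewrite !mxE ord1.
move: ab; rewrite le_eqVlt => /predU1P[->|ab]; first by rewrite !subrr normr0 mulr0.
have [|| c] := @MVT R (fun s => y s i 0) (fun s => dy s i 0) a b ab.
- move=> x; rewrite in_itv /= => /andP[ax xb]; apply: is_derive_coord.
  by apply: Hy; rewrite !ltW.
- apply: derivable_within_continuous => x; rewrite in_itv /= => axb.
  exact: (@ex_derive _ _ _ _ _ _ _ (is_derive_coord i (Hy _ axb))).
rewrite in_itv /= => cab ->; rewrite normrM [`|b - a|]ger0_norm ?subr_ge0 ?(ltW ab)//.
by rewrite ler_wpM2r ?subr_ge0 ?(ltW ab)// (le_trans (coord_le_norm _ _ _))// HM.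
Qed.

(** Up to the first time the solution reaches the boundary of the unit ball its
    speed is at most M, so it cannot have travelled a distance 1 by then. *)
Lemma solution_stays m (F : 'cV[R]_m -> 'cV[R]_m) (M T : R) (y : R -> 'cV[R]_m) :
  0 <= M -> M * T < 1 -> is_solution F T y ->
  (forall x, `|x - y 0| <= 1 -> `|F x| <= M) ->
  forall t, 0 <= t <= T -> `|y t - y 0| <= 1.
Proof.
move=> M0 MT Hy HF t1 /andP[t10 t1T]; rewrite leNgt; apply/negP => far.
pose S : set R := [set t | 0 <= t <= t1 /\ 1 <= `|y t - y 0|].
have St1 : S t1 by split; [rewrite t10 lexx|exact: ltW].
have lS : has_lbound S by exists 0 => t [/andP[]].
have hS : has_inf S by split=> //; exists t1.
pose t := inf S.
have tt1 : t <= t1 by exact: ge_inf.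
have t0 : 0 <= t by apply: lb_le_inf; [exists t1|move=> s [/andP[]]].
have before s : 0 <= s -> s < t -> `|y s - y 0| < 1.
  move=> s0 st; rewrite ltNge; apply/negP => sS.
  have : t <= s by apply: ge_inf => //; split=> //; rewrite s0 (le_trans (ltW st)).
  by rewrite leNgt st.
have tT : t <= T by exact: le_trans t1T.
have small : `|y t - y 0| < 1.
  apply: (@le_lt_trans _ _ (M * (t - 0))).
    apply: (@mean_value_bound _ y (fun s => F (y s))) => // s /andP[s0 st].
      by apply: Hy; rewrite s0 (le_trans st).
    by apply/HF/ltW/before => //; exact: ltW.
  by rewrite subr0 (le_lt_trans _ MT)// ler_wpM2l.
have ct : {for t, continuous y}.
  by apply: is_derive_continuous; apply: Hy; rewrite t0.
have cn : `|y s - y 0| @[s --> t] --> `|y t - y 0|.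
  by apply: cvg_norm; apply: cvgB => //; exact: cvg_cst.
have /nbhs_ballP[r /= r0 Hr] : \forall s \near t, `|y s - y 0| < 1.
  exact: (cvgr_lt _ cn).
have [s Ss] := inf_adherent r0 hS; rewrite -/t => st.
have ts : t <= s by exact: ge_inf.
have : `|y s - y 0| < 1.
  apply: Hr; rewrite /ball /= ler0_norm ?subr_le0// opprB ltrBlDl//.
by rewrite ltNge Ss.2.
Qed.

(** The limit is trapped between the nondecreasing u_n - 2 B / 2^n and the
    nonincreasing u_n + 2 B / 2^n. *)
Lemma geometric_limit (u : nat -> R) (B : R) : 0 <= B ->
  (forall n, `|u n.+1 - u n| <= B * 2^-1 ^+ n) ->
  {l | forall n, `|l - u n| <= 2 * B * 2^-1 ^+ n}.
Proof.
move=> B0 Hu.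
pose v n := u n - 2 * B * 2^-1 ^+ n; pose w n := u n + 2 * B * 2^-1 ^+ n.
have e n : 2 * B * 2^-1 ^+ n.+1 = B * 2^-1 ^+ n :> R by rewrite exprS; field.
have vS n : v n <= v n.+1.
  by move: (Hu n); rewrite /v e ler_norml => /andP[]; lra.
have wS n : w n.+1 <= w n.
  by move: (Hu n); rewrite /w e ler_norml => /andP[]; lra.
have vI := nondecreasing_seqP v; have wI := nonincreasing_seqP w.
have vw m n : v m <= w n.
  apply: (@le_trans _ _ (v (maxn m n))); first by apply: vI.1 => //; exact: leq_maxl.
  apply: (@le_trans _ _ (w (maxn m n))); last by apply: wI.1 => //; exact: leq_maxr.
  rewrite /v /w lerD2l; have : 0 <= 2 * B * 2^-1 ^+ (maxn m n) :> R.
    by rewrite !mulr_ge0 ?exprn_ge0.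
  by lra.
exists (sup (range v)) => n.
have : v n <= sup (range v).
  by apply: ub_le_sup; [exists (w 0) => _ [k _ <-]|exists n].
have : sup (range v) <= w n.
  by apply: ge_sup; [exists (v 0); exists 0|move=> _ [k _ <-]].
by rewrite /v /w => h1 h2; rewrite ler_norml; apply/andP; split; lra.
Qed.

Definition antiderivative m (g : R -> 'cV[R]_m) (t : R) : 'cV[R]_m :=
  \col_i (\int[lebesgue_measure]_(s in `[-1, t]) g s i 0
          - \int[lebesgue_measure]_(s in `[-1, 0]) g s i 0).

Lemma antiderivative0 m (g : R -> 'cV[R]_m) : antiderivative g 0 = 0.
Proof. by apply/colP => i; rewrite !mxE subrr. Qed.

Lemma antiderivative_is_derive m (g : R -> 'cV[R]_m) (t : R) :
  continuous g -> -1 < t -> is_derive t (1 : R) (antiderivative g) (g t).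
Proof.
move=> cg t1; apply: is_derive_col => i.
pose gi : R -> R := fun s => g s i 0.
have cgi : continuous gi.
  move=> s; apply: (@continuous_comp _ _ _ g (fun v : 'cV[R]_m => v i 0)) => //.
    exact: cg.
  exact: coord_continuous.
have ig : (@lebesgue_measure R).-integrable `[-1, (t + 1)] (EFin \o gi).
  have cw : {within `[-1, (t + 1)], continuous gi}.
    by apply: continuous_subspaceT => x; exact: cgi.
  apply: continuous_compact_integrable => //; exact: segment_compact.
have tt : t < t + 1 by rewrite ltrDl.
have [dF vF] := continuous_FTC1_closed tt ig t1 (cgi t).
pose F x := \int[lebesgue_measure]_(s in `[-1, x]) gi s.
have DF : is_derive t (1 : R) F (gi t) by apply: DeriveDef dF _; rewrite -derive1E.
have -> : (fun s => antiderivative g s i 0) = (fun x => F x - F 0).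
  by apply/funext => x; rewrite mxE.
have := is_deriveB DF (is_derive_cst (F 0) t 1).
by rewrite subr0.
Qed.

End ordinary_differential_equations.

Section pairing.
Context {R : realType}.

Lemma is_derive_fun_sum n (f : 'I_n -> R -> R) (df : 'I_n -> R) (t : R) :
  (forall i, is_derive t (1 : R) (f i) (df i)) ->
  is_derive t (1 : R) (fun t => \sum_i f i t) (\sum_i df i).
Proof.
move=> H; rewrite (_ : (fun t => _) = \sum_i f i); first exact: is_derive_sum.
by apply/funext => u; rewrite fct_sumE.
Qed.

(** The coupling matrices of the linearized equation and of its adjoint are
    negative transposes of each other, so the derivative of the pairing of two
    solutions vanishes. *)
Lemma pairing_constant m (J : R -> 'M[R]_m) (p d : R -> 'cV[R]_m) (T : R) :
  0 <= T ->
  (forall t, 0 <= t <= T -> is_derive t (1 : R) p ((J t)^T *m p t)) ->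
  (forall t, 0 <= t <= T -> is_derive t (1 : R) d (- J t *m d t)) ->
  \sum_l p T l 0 * d T l 0 = \sum_l p 0 l 0 * d 0 l 0.
Proof.
move=> T0 dp dd; pose g t := \sum_l p t l 0 * d t l 0.
have dg t : 0 <= t <= T -> is_derive t (1 : R) g 0.
  move=> tT; have -> : 0 = \sum_l (p t l 0 * (- J t *m d t) l 0
      + d t l 0 * ((J t)^T *m p t) l 0) :> R.
    rewrite big_split /= [X in _ + X](_ : _ = \sum_l p t l 0 * (J t *m d t) l 0).
      rewrite -big_split /= big1 // => l _.
      by rewrite mulNmx [(- (J t *m d t)) _ _]mxE mulrN addrC subrr.
    under eq_bigr do rewrite mxE mulr_sumr.
    rewrite exchange_big /=; apply: eq_bigr => l _.
    rewrite mxE mulr_sumr; apply: eq_bigr => k _.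
    by rewrite mxE mulrCA mulrC -mulrA mulrCA mulrA mulrAC -mulrA.
  apply: is_derive_fun_sum => l.
  exact: (is_deriveM (is_derive_coord l (dp t tT)) (is_derive_coord l (dd t tT))).
have : `|(\col_(i < 1) g T) - (\col_(i < 1) g 0)| <= 0 * (T - 0).
  apply: (@mean_value_bound R 1 (fun t => \col_(i < 1) g t) (fun=> 0)) => //.
    move=> t tT; apply: is_derive_col => i; rewrite [X in is_derive _ _ _ X]mxE.
    rewrite (_ : (fun s => _) = g); first exact: dg.
    by apply/funext => u; rewrite mxE.
  by move=> t _; rewrite normr0.
rewrite mul0r normr_le0 subr_eq0 => /eqP/(congr1 (fun v : 'cV[R]_1 => v 0 0)).
by rewrite !mxE.
Qed.

End pairing.

Definition clamp {R : realType} (T t : R) : R := Num.max 0 (Num.min t T).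

Section linear_equation.
Context {R : realType} (m : nat) (G : R -> 'M[R]_m) (M T : R) (x0 : 'cV[R]_m).
Hypotheses (T0 : 0 <= T) (M0 : 0 <= M) (MT : M * T <= 2^-1).
Hypothesis cG : forall i j, continuous (fun t => G t i j).
Hypothesis GM : forall t (v : 'cV[R]_m), `|G t *m v| <= M * `|v|.

Let c := clamp T.

Lemma clamp_itv t : 0 <= clamp T t <= T.
Proof. by rewrite /clamp le_max lexx ge_max T0 ge_min lexx orbT. Qed.

Lemma clamp_id t : 0 <= t <= T -> clamp T t = t.
Proof. by move=> /andP[t0 tT]; rewrite /clamp (min_idPl tT) (max_idPr t0). Qed.

Lemma clamp_continuous : continuous (clamp T).
Proof.
have c1 (t : R^o) : {for t, continuous (fun t : R^o => Num.min t T : R^o)}.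
  by apply: (@continuous_min R R^o id (cst T)) => //; exact: cst_continuous.
move=> t; apply: (@continuous_max R R^o (cst 0) (fun t => Num.min t T)) => //.
exact: cst_continuous.
Qed.

Let GX (X : R -> 'cV[R]_m) s := G s *m X s.

Let GX_continuous (X : R -> 'cV[R]_m) : continuous X -> continuous (GX X).
Proof.
move=> cX s; apply: continuous_mxP => i j.
rewrite (_ : (fun y => _) = fun y => \sum_k G y i k * X y k j); last first.
  by apply/funext => y; rewrite mxE.
apply: (@continuous_sum _ _ R^o) => k _.
have cXk : {for s, continuous (fun y => X y k j)}.
  apply: (@continuous_comp _ _ _ X (fun v : 'cV[R]_m => v k j)); first exact: cX.
  exact: coord_continuous.
by apply: continuous_mul => //; exact: cG.
Qed.

Let Phi (X : R -> 'cV[R]_m) (t : R) := x0 + antiderivative (GX X) t.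

Let Phi_is_derive (X : R -> 'cV[R]_m) (t : R) : continuous X -> -1 < t ->
  is_derive t (1 : R) (Phi X) (G t *m X t).
Proof.
move=> /GX_continuous cX t1.
have := is_deriveD (is_derive_cst x0 t 1) (antiderivative_is_derive cX t1).
by rewrite add0r.
Qed.

Let itv_gtN1 (t : R) : 0 <= t -> -1 < t.
Proof. by apply: lt_le_trans; rewrite ltrN10. Qed.

Let Phi0 X : Phi X 0 = x0.
Proof. by rewrite /Phi antiderivative0 addr0. Qed.

Let Phi_lip (X X' : R -> 'cV[R]_m) (K s : R) : continuous X -> continuous X' -> 0 <= K ->
  (forall t, `|X t - X' t| <= K) -> 0 <= s <= T ->
  `|Phi X s - Phi X' s| <= K / 2.
Proof.
move=> cX cX' K0 XK /andP[s0 sT].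
have := @mean_value_bound R m (fun t => Phi X t - Phi X' t)
  (fun t => G t *m (X t - X' t)) 0 s (M * K) s0.
rewrite !Phi0 subrr !subr0 => B; apply: (@le_trans _ _ (M * K * s)).
  apply: B => [|t /andP[t0 ts]|t _]; first exact: mulr_ge0.
    rewrite mulmxBr.
    by apply: is_deriveB; apply: Phi_is_derive => //; exact: itv_gtN1.
  by rewrite (le_trans (GM _ _))// ler_wpM2l.
rewrite mulrAC mulrC ler_wpM2l//; apply: le_trans MT.
by rewrite ler_wpM2l.
Qed.

Let X_ n := iter n (fun X t => Phi X (c t)) (fun=> x0).

Let X_continuous n : continuous (X_ n).
Proof.
elim: n => [|n IH] t; first exact: cst_continuous.
apply: (@continuous_comp _ _ _ c (Phi (X_ n))); first exact: clamp_continuous.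
apply: is_derive_continuous (Phi_is_derive IH _); apply: itv_gtN1.
by have /andP[] := clamp_itv t.
Qed.

Let B := `|x0|.

Let B0 : 0 <= B.
Proof. exact: normr_ge0. Qed.

Let X_step n t : `|X_ n.+1 t - X_ n t| <= B * 2^-1 ^+ n.
Proof.
elim: n t => [|n IH] t.
  rewrite expr0 mulr1 -[X_ 0 t](Phi0 (X_ 0)).
  have /andP[s0 sT] := clamp_itv t.
  have := @mean_value_bound R m (Phi (X_ 0)) (fun t => G t *m X_ 0 t) 0 (c t)
    (M * B) s0 (mulr_ge0 M0 (normr_ge0 _)).
  rewrite subr0 => h; apply: (@le_trans _ _ (M * B * c t)).
    apply: h => [u /andP[u0 _]|u _]; last exact: GM.
    by apply: Phi_is_derive => //; exact: itv_gtN1.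
  rewrite mulrAC ler_piMl//; apply: (@le_trans _ _ 2^-1); last first.
    by rewrite invf_le1// ler1n.
  by apply: le_trans MT; rewrite ler_wpM2l.
apply: le_trans (@Phi_lip (X_ n.+1) (X_ n) (B * 2^-1 ^+ n) _ _ _ _ _ (clamp_itv t)) _ => //.
  by rewrite mulr_ge0 ?exprn_ge0.
by rewrite -mulrA -exprSr.
Qed.

Let lim_X t i : {l | forall n, `|l - X_ n t i 0| <= 2 * B * 2^-1 ^+ n}.
Proof.
apply: geometric_limit => [|n]; first exact: normr_ge0.
apply: le_trans (X_step n t).
by have := coord_le_norm (X_ n.+1 t - X_ n t) i 0; rewrite !mxE.
Qed.

Let X t : 'cV[R]_m := \col_i sval (lim_X t i).

Let X_lim n t : `|X t - X_ n t| <= 2 * B * 2^-1 ^+ n.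
Proof.
apply: norm_le_coord => [|i j]; first by rewrite !mulr_ge0 ?exprn_ge0.
by rewrite !mxE ord1; exact: (svalP (lim_X t i)).
Qed.

Let geometric_small (e : R) : 0 < e -> exists n, 2 * B * 2^-1 ^+ n < e.
Proof.
move=> e0.
have C := @cvg_geometric R (2 * B) 2^-1.
have : `|2^-1 : R| < 1 by rewrite ger0_norm// invf_lt1// ltr1n.
move=> /C /cvgr_lt /(_ e e0)[N _ /(_ N)] h.
by exists N; exact: (h (leqnn N)).
Qed.

Let X_cont : continuous X.
Proof.
move=> t; apply/(@cvgrPdist_le _ _ _ (nbhs t)) => e e0.
have e3 : 0 < e / 3 by rewrite divr_gt0.
have [n hn] := geometric_small e3.
have := @X_continuous n t.
move=> /(@cvgrPdist_le _ _ _ (nbhs t)) /(_ (e / 3) e3).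
apply: filterS => s hs.
rewrite -[X in `|X|](subrKA (X_ n t)) -[X in _ + X](subrKA (X_ n s)).
rewrite (le_trans (ler_normD _ _))// (_ : e = e / 3 + (e / 3 + e / 3)); last by field.
rewrite lerD ?(le_trans (X_lim _ _) (ltW hn))// (le_trans (ler_normD _ _))// lerD//.
by rewrite distrC (le_trans (X_lim _ _) (ltW hn)).
Qed.

Let X_fixed t : 0 <= t <= T -> X t = Phi X t.
Proof.
move=> tT; apply/eqP; rewrite -subr_eq0 -normr_le0.
apply/ler_addgt0Pl => e e0; rewrite addr0.
have [n hn] := geometric_small e0.
apply: le_trans (ltW hn).
rewrite -(subrKA (X_ n.+1 t)) (le_trans (ler_normD _ _))//.
have -> : 2 * B * 2^-1 ^+ n = 2 * B * 2^-1 ^+ n.+1 + 2 * B * 2^-1 ^+ n / 2.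
  by rewrite exprSr mulrA; field.
rewrite lerD// /X_ /= /c clamp_id//; apply: Phi_lip => //; first exact: X_continuous.
  by rewrite !mulr_ge0 ?exprn_ge0.
by move=> s; rewrite distrC; exact: X_lim.
Qed.

Lemma linear_ode_line : exists x : R -> 'cV[R]_m, x 0 = x0 /\
  forall t, 0 <= t <= T -> is_derive t (1 : R) x (G t *m x t).
Proof.
exists (Phi X); split=> [|t tT]; first exact: Phi0.
rewrite -X_fixed//; apply: Phi_is_derive => //.
by apply: itv_gtN1; case/andP: tT.
Qed.

End linear_equation.

(** Picard iteration. The iterates are frozen outside [0, T], so that they are
    defined and continuous on the whole line while the solution is two-sidedly
    differentiable at both ends of the interval. *)
Lemma linear_ode_exists (R : realType) m (G : R -> 'M[R]_m) (M T : R)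
    (x0 : 'cV[R]_m) :
  0 <= T -> 0 <= M -> M * T <= 2^-1 ->
  (forall t i j, 0 <= t <= T -> {for t, continuous (fun t => G t i j)}) ->
  (forall t (v : 'cV[R]_m), 0 <= t <= T -> `|G t *m v| <= M * `|v|) ->
  exists x : R -> 'cV[R]_m, x 0 = x0 /\
  forall t, 0 <= t <= T -> is_derive t (1 : R) x (G t *m x t).
Proof.
move=> T0 M0 MT cG GM.
have [||x [x00 dx]] := @linear_ode_line R m (fun t => G (clamp T t)) M T x0 T0 M0 MT.
- move=> i j t; apply: (@continuous_comp _ _ _ (clamp T) (fun t => G t i j)).
    exact: clamp_continuous.
  by apply: cG; exact: clamp_itv.
- by move=> t v; apply: GM; exact: clamp_itv.
by exists x; split=> // t tT; have := dx t tT; rewrite clamp_id.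
Qed.

(** * Stages, their linearization, and the momentum system *)

Section explicit_stages.
Context {R : realType} (s m : nat) (f : 'cV[R]_m -> 'cV[R]_m) (L : 'M[R]_s).
Implicit Types (tau : R) (q : 'cV[R]_m) (k : 'I_s -> 'cV[R]_m).

Lemma eq_stage_point tau q k k' (i : 'I_s) :
  (forall j : 'I_s, (j < i)%N -> k j = k' j) ->
  stage_point L tau q k i = stage_point L tau q k' i.
Proof.
by move=> kk'; rewrite /stage_point; congr (_ + _ *: _); apply: eq_bigr => j /kk' ->.
Qed.

Lemma rk_eval_stages tau q n (i : 'I_s) : (i < n)%N ->
  rk_eval f L tau q n i = f (stage_point L tau q (rk_eval f L tau q n) i).
Proof.
elim: n => [//|n IH] in i *; rewrite ltnS leq_eqVlt.
have lt_eq (j : 'I_s) : (j < i <= n)%N -> rk_eval f L tau q n.+1 j = rk_eval f L tau q n j.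
  by move=> /andP[ji in_] /=; rewrite ltn_eqF// (leq_trans ji).
move=> /predU1P[ein|lin].
  rewrite [LHS]/= ein eqxx; congr f; apply: eq_stage_point => j ji.
  by rewrite lt_eq// ji ein /=.
rewrite [LHS]/= ltn_eqF// IH//; congr f; apply: eq_stage_point => j ji.
by rewrite lt_eq// ji ltnW.
Qed.

Lemma rk_stages_eval tau q k :
  rk_stages f L tau q k <-> k =1 rk_eval f L tau q s.
Proof.
split=> [kst|keq].
  suff H n (i : 'I_s) : (i < n)%N -> rk_eval f L tau q n i = k i.
    by move=> i; rewrite H.
  elim: n i => [//|n IH] i; rewrite ltnS leq_eqVlt /=.
  case: eqP => /= [ein _|_ lin]; last exact: IH.
  by rewrite kst; congr f; apply: eq_stage_point => j ji; rewrite IH// -ein.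
move=> i; rewrite keq rk_eval_stages//; congr f.
by apply: eq_stage_point => j _; rewrite keq.
Qed.

End explicit_stages.

Section transposed_tangent.
Context {R : realType} (s : nat) (L : 'M[R]_s) (b : 'cV[R]_s).

Definition nc_sum (r : seq (ncpoly R s)) : ncpoly R s :=
  foldr (@NCadd R s) (NCconst s 0) r.

(** The recursion of the stages of the linearized method, transposed, hence with
    the factors in reverse order. *)
Fixpoint tangent_poly (n : nat) : 'I_s -> ncpoly R s :=
  if n is n'.+1 then fun i =>
    if i == n' :> nat then
      NCmul (NCconst s (- 1)) (NCmul
        (NCadd (NCconst s 1)
          (nc_sum [seq NCmul (NCconst s (L i j)) (tangent_poly n' j)
                  | j : 'I_s <- enum 'I_s & (j < i)%N]))
        (NCvar R i))
    else tangent_poly n' i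
  else fun=> NCconst s 0.

Definition rho_poly : ncpoly R s :=
  nc_sum [seq NCmul (NCconst s (b i 0)) (tangent_poly s i) | i <- enum 'I_s].

Context (m : nat) (N : 'I_s -> 'M[R]_m).

Lemma nceval_sum I (r : seq I) (P : pred I) (c : I -> R) (E : I -> ncpoly R s) :
  nceval N (nc_sum [seq NCmul (NCconst s (c i)) (E i) | i <- r & P i]) =
  \sum_(i <- r | P i) c i *: nceval N (E i).
Proof.
elim: r => [|i r IH]; first by rewrite big_nil /= raddf0.
by rewrite big_cons /=; case: ifP => _ //=; rewrite IH mul_scalar_mx.
Qed.

Definition tangent (i : 'I_s) : 'M[R]_m := nceval N (tangent_poly s i).

Lemma tangentE i :
  tangent i = - (1%:M + \sum_(j < s | (j < i)%N) L i j *: tangent j) *m N i.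
Proof.
have stab n (j : 'I_s) : (j < n)%N -> forall k, (n <= k)%N ->
    tangent_poly k j = tangent_poly n j.
  move=> jn; elim=> [|k IH]; first by rewrite leqn0 => /eqP n0; rewrite n0 in jn.
  rewrite leq_eqVlt => /predU1P[<-//|]; rewrite ltnS => nk.
  by rewrite /= ltn_eqF ?IH// (leq_trans jn).
rewrite /tangent (stab i.+1 i)//= eqxx /= nceval_sum mul_scalar_mx scaleN1r.
rewrite mulNmx big_enum_cond /=; congr (- ((_ + _) *m _)).
by apply: eq_bigr => j ji; rewrite (stab i j)// ltnW.
Qed.

Lemma rho_polyE : nceval N rho_poly = \sum_i b i 0 *: tangent i.
Proof.
rewrite /rho_poly -[enum 'I_s]filter_predT nceval_sum.
by rewrite big_enum_cond /=.
Qed.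

End transposed_tangent.

Section momentum_stages.
Context {R : realType} (s : nat) (L : 'M[R]_s) (b : 'cV[R]_s).
Hypotheses (L_lower : strictly_lower L) (b_neq0 : forall i, b i 0 != 0).

Lemma symplectic_companionE i j :
  symplectic_companion L b i j = b j 0 - (b i 0)^-1 * b j 0 * L j i.
Proof.
pose c : 'cV[R]_s := \col_i (b i 0)^-1.
have bc : diag_mx c^T *m diag_mx b^T = 1%:M.
  rewrite mulmx_diag -diag_const_mx; congr diag_mx.
  by apply/rowP => k; rewrite !mxE mulVf.
have ic : invmx (diag_mx b^T) = diag_mx c^T.
  by have [_ U] := mulmx1_unit bc; rewrite -[LHS]mul1mx -bc mulmxK.
rewrite /symplectic_companion ic.
rewrite mxE; congr (_ + _).
  by rewrite mxE big_ord1 !mxE mul1r.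
by rewrite mxE mul_mx_diag mxE mul_diag_mx !mxE mulrAC.
Qed.

Context (m : nat) (tau : R) (M : 'I_s -> 'M[R]_m).

Let E i := tangent L (fun i => tau *: M i) i.
Definition momentum_mx : 'M[R]_m := 1%:M + \sum_i b i 0 *: E i.

Let stages (p : 'cV[R]_m) (l : 'I_s -> 'cV[R]_m) := forall i,
  l i = M i *m (p + tau *: \sum_j symplectic_companion L b i j *: l j).

(** The stage value of the momentum, counted backwards from the new momentum:
    only the stages after the i-th one enter. *)
Definition backward_point (p1 : 'cV[R]_m) (l : 'I_s -> 'cV[R]_m) (i : 'I_s) :=
  p1 - tau *: \sum_j ((b i 0)^-1 * b j 0 * L j i) *: l j.

Lemma companion_backward p l i :
  p + tau *: \sum_j symplectic_companion L b i j *: l j =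
  backward_point (rk_update b tau p l) l i.
Proof.
rewrite /backward_point /rk_update -addrA -scalerBr; congr (_ + _ *: _).
by rewrite -sumrB; apply: eq_bigr => j _; rewrite symplectic_companionE scalerBl.
Qed.

(** The discrete counterpart of the conservation of the pairing of a solution of
    the linearized equation with a solution of the adjoint equation. Applying the
    recursion of tangent to the momentum stages and summing over them with the
    weights b produces two double sums over pairs of stages; the coefficients of
    backward_point are those for which the two agree after exchanging the indices. *)
Lemma momentum_conservation p l :
  (forall i, l i = M i *m backward_point (rk_update b tau p l) l i) ->
  momentum_mx *m rk_update b tau p l = p.
Proof.
set p1 := rk_update b tau p l => lE.
have Ep i : E i *m backward_point p1 l i =
   - (tau *: l i) - \sum_j L i j *: (E j *m (tau *: l i)).
  rewrite /E tangentE -mulmxA -scalemxAl -lE mulNmx mulmxDl mul1mx.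
  rewrite opprD mulmx_suml; congr (_ - _).
  rewrite big_mkcond /=; apply: eq_bigr => j _.
  case: ifP => ji; first by rewrite -scalemxAl.
  by rewrite L_lower ?scale0r// leqNgt ji.
have S : \sum_i b i 0 *: (E i *m backward_point p1 l i) =
   \sum_i b i 0 *: (E i *m p1)
    - \sum_i \sum_j (b j 0 * L j i) *: (E i *m (tau *: l j)).
  rewrite -sumrB; apply: eq_bigr => i _.
  rewrite /backward_point mulmxBr scalerBr; congr (_ - _).
  rewrite -scalemxAr scalerA mulmx_sumr scaler_sumr; apply: eq_bigr => j _.
  rewrite -!scalemxAr !scalerA; congr (_ *: _).
  by rewrite -mulrA mulrCA [RHS]mulrC; congr (_ * _); rewrite !mulrA mulfV// mul1r.
have S' : \sum_i b i 0 *: (E i *m backward_point p1 l i) =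
   - (tau *: \sum_i b i 0 *: l i)
    - \sum_i \sum_j (b i 0 * L i j) *: (E j *m (tau *: l i)).
  rewrite scaler_sumr -sumrN -sumrB; apply: eq_bigr => i _.
  rewrite Ep scalerBr scalerN scalerA mulrC -scalerA; congr (_ - _).
  by rewrite scaler_sumr; apply: eq_bigr => j _; rewrite scalerA.
rewrite /momentum_mx mulmxDl mul1mx mulmx_suml.
under eq_bigr do rewrite -scalemxAl.
move: S; rewrite S' exchange_big /= => /addIr <-.
by rewrite /p1 /rk_update addrK.
Qed.

(** The i-th equation involves only later unknowns, so s rounds of substitution
    settle all of them. *)
Lemma triangular_fixpoint (V : Type) (v0 : V) (F : ('I_s -> V) -> 'I_s -> V) :
  (forall k k' (i : 'I_s), (forall j : 'I_s, (i < j)%N -> k j = k' j) ->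
    F k i = F k' i) ->
  exists k, forall i, k i = F k i.
Proof.
move=> HF; exists (iter s F (fun=> v0)).
suff H n (i : 'I_s) : (s - i <= n)%N ->
    iter n F (fun=> v0) i = iter n.+1 F (fun=> v0) i by move=> i; apply: H; exact: leq_subr.
elim: n i => [|n IH] i; first by rewrite leqn0 subn_eq0 leqNgt ltn_ord.
move=> si; rewrite !iterS; apply: HF => j ij; rewrite -iterS; apply: IH.
by rewrite -ltnS (leq_trans _ si)// ltn_sub2l.
Qed.

Lemma triangular_fixpoint_unique (V : Type) (F : ('I_s -> V) -> 'I_s -> V) k k' :
  (forall k k' (i : 'I_s), (forall j : 'I_s, (i < j)%N -> k j = k' j) ->
    F k i = F k' i) ->
  (forall i, k i = F k i) -> (forall i, k' i = F k' i) -> k =1 k'.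
Proof.
move=> HF Hk Hk'.
suff H n (i : 'I_s) : (s - i <= n)%N -> k i = k' i.
  by move=> i; apply: (H s); exact: leq_subr.
elim: n i => [|n IH] i; first by rewrite leqn0 subn_eq0 leqNgt ltn_ord.
move=> si; rewrite Hk Hk'; apply: HF => j ij; apply: IH.
by rewrite -ltnS (leq_trans _ si)// ltn_sub2l.
Qed.

Lemma backward_point_later p1 l l' (i : 'I_s) :
  (forall j : 'I_s, (i < j)%N -> l j = l' j) ->
  M i *m backward_point p1 l i = M i *m backward_point p1 l' i.
Proof.
move=> ll; rewrite /backward_point; congr (_ *m (_ - _ *: _)).
apply: eq_bigr => j _; have [ij|ji] := ltnP i j; first by rewrite ll.
by rewrite L_lower// mulr0 !scale0r.
Qed.

(** Once the new momentum p1 is known the stages follow by backward substitution,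
    and conservation says that p1 must be the inverse of the momentum matrix
    applied to p; so the large system for all stages is solvable as soon as this
    one small matrix is invertible. *)
Lemma momentum_stages_unique p : momentum_mx \in unitmx ->
  exists! l : 'I_s -> 'cV[R]_m, stages p l.
Proof.
move=> U.
pose p1 := invmx momentum_mx *m p.
have [l lE] := triangular_fixpoint 0 (backward_point_later p1).
have st l' : stages p l' ->
    rk_update b tau p l' = p1 /\ forall i, l' i = M i *m backward_point p1 l' i.
  move=> H.
  have H' i : l' i = M i *m backward_point (rk_update b tau p l') l' i.
    by rewrite -companion_backward.
  have e : rk_update b tau p l' = p1.
    by rewrite /p1 -[in RHS](momentum_conservation H') mulKmx.
  by split=> // i; rewrite H' e.
exists l; split; last first.
  move=> l' /st[_ l'E]; apply/funext.
  exact: (triangular_fixpoint_unique (backward_point_later p1)).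
pose p' := p1 - tau *: \sum_i b i 0 *: l i.
have e1 : rk_update b tau p' l = p1 by rewrite /rk_update subrK.
have e : p' = p.
  rewrite -(@momentum_conservation p' l); last by move=> i; rewrite e1.
  by rewrite e1 /p1 mulKVmx.
by move=> i; rewrite -e companion_backward e1.
Qed.

End momentum_stages.

(** * Regularity and derivative of the position update *)

Section function_class.
Context {R : realType} (X : Type) (C : set (X -> R)).

(** Being of class C^k in the initial position, being jointly continuous in the
    step size and the position, and being differentiable at a point are all such
    classes; the formulas of the method are traversed once for all of them. *)
Record smooth_class : Prop := SmoothClass {
  class_cst : forall c, C (fun=> c);
  class_add : forall f g, C f -> C g -> C (fun x => f x + g x);
  class_mul : forall f g, C f -> C g -> C (fun x => f x * g x);
  class_comp : forall n (f : 'cV[R]_n -> R) (g : X -> 'cV[R]_n), smooth f ->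
    (forall i, C (fun x => g x i 0)) -> C (fun x => f (g x)) }.

Hypothesis HC : smooth_class.

Lemma class_sum I (r : seq I) (P : pred I) (f : I -> X -> R) :
  (forall i, P i -> C (f i)) -> C (fun x => \sum_(i <- r | P i) f i x).
Proof.
move=> Cf; elim: r => [|i r IH].
  rewrite (_ : (fun _ => _) = fun=> 0); first exact: (class_cst HC).
  by apply/funext => x; rewrite big_nil.
rewrite (_ : (fun _ => _) = if P i
    then (fun x => f i x + \sum_(j <- r | P j) f j x)
    else (fun x => \sum_(j <- r | P j) f j x)).
  by case: ifP => // Pi; apply: (class_add HC) => //; exact: Cf.
by apply/funext => x; rewrite big_cons; case: ifP.
Qed.

Lemma class_prod I (r : seq I) (f : I -> X -> R) :
  (forall i, C (f i)) -> C (fun x => \prod_(i <- r) f i x).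
Proof.
move=> Cf; elim: r => [|i r IH].
  rewrite (_ : (fun _ => _) = fun=> 1); first exact: (class_cst HC).
  by apply/funext => x; rewrite big_nil.
rewrite (_ : (fun _ => _) = fun x => f i x * \prod_(j <- r) f j x).
  exact: (class_mul HC).
by apply/funext => x; rewrite big_cons.
Qed.

Lemma class_det n (B : X -> 'M[R]_n) :
  (forall i j, C (fun x => B x i j)) -> C (fun x => \det (B x)).
Proof.
move=> CB; apply: class_sum => u _; apply: (class_mul HC); first exact: (class_cst HC).
exact: class_prod.
Qed.

Lemma class_adj n (B : X -> 'M[R]_n) i j :
  (forall i j, C (fun x => B x i j)) -> C (fun x => (\adj (B x)) i j).
Proof.
move=> CB; rewrite (_ : (fun _ => _) =
  fun x => (-1) ^+ (j + i) * \det (row' j (col' i (B x)))); last first.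
  by apply/funext => x; rewrite mxE.
apply: (class_mul HC); first exact: (class_cst HC).
apply: class_det => u v; rewrite (_ : (fun _ => _) = fun x => B x (lift j u) (lift i v)) //.
by apply/funext => x; rewrite !mxE.
Qed.

Context (s m : nat) (f : 'cV[R]_m -> 'cV[R]_m) (L : 'M[R]_s) (b : 'cV[R]_s).
Context (tau : X -> R) (q : X -> 'cV[R]_m).
Hypothesis sf : smooth_field f.
Hypothesis Ctau : C tau.
Hypothesis Cq : forall i, C (fun x => q x i 0).

Lemma class_stage_point (k : X -> 'I_s -> 'cV[R]_m) i r :
  (forall j r, C (fun x => k x j r 0)) ->
  C (fun x => stage_point L (tau x) (q x) (k x) i r 0).
Proof.
move=> Ck; rewrite (_ : (fun x => stage_point _ _ _ _ _ _ _) = fun x => q x r 0 +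
   tau x * \sum_(j < s | (j < i)%N) L i j * k x j r 0); last first.
  apply/funext => x; rewrite !mxE summxE; congr (_ + _ * _).
  by apply: eq_bigr => j _; rewrite mxE.
apply: (class_add HC) => //; apply: (class_mul HC) => //; apply: class_sum => j _.
by apply: (class_mul HC) => //; exact: (class_cst HC).
Qed.

Lemma class_rk_eval n i r : C (fun x => rk_eval f L (tau x) (q x) n i r 0).
Proof.
elim: n i r => [|n IH] i r.
  rewrite (_ : (fun _ => _) = fun=> 0); first exact: (class_cst HC).
  by apply/funext => x; rewrite mxE.
rewrite (_ : (fun x => _) = if i == n :> nat
  then fun x => f (stage_point L (tau x) (q x) (rk_eval f L (tau x) (q x) n) i) r 0
  else fun x => rk_eval f L (tau x) (q x) n i r 0); last first.
  by apply/funext => x /=; case: ifP.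
case: ifP => // _.
apply: (class_comp HC (f := fun v => f v r 0)); first exact: sf.
by move=> l; apply: class_stage_point => j u; exact: IH.
Qed.

Lemma class_rk_update r :
  C (fun x => rk_update b (tau x) (q x) (rk_eval f L (tau x) (q x) s) r 0).
Proof.
rewrite (_ : (fun x => rk_update _ _ _ _ _ _) = fun x => q x r 0 +
   tau x * \sum_i b i 0 * rk_eval f L (tau x) (q x) s i r 0); last first.
  apply/funext => x; rewrite !mxE summxE; congr (_ + _ * _).
  by apply: eq_bigr => j _; rewrite mxE.
apply: (class_add HC) => //; apply: (class_mul HC) => //; apply: class_sum => j _.
by apply: (class_mul HC); [exact: (class_cst HC)|exact: class_rk_eval].
Qed.

Lemma class_nceval (N : X -> 'I_s -> 'M[R]_m) (P : ncpoly R s) :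
  (forall i u v, C (fun x => N x i u v)) ->
  forall u v, C (fun x => nceval (N x) P u v).
Proof.
move=> CN; elim: P => [c|i|P IHP Q IHQ|P IHP Q IHQ] u v //=.
- exact: (class_cst HC).
- rewrite (_ : (fun _ => _) = fun x => nceval (N x) P u v + nceval (N x) Q u v).
    exact: (class_add HC).
  by apply/funext => x; rewrite mxE.
rewrite (_ : (fun _ => _) = fun x => \sum_l nceval (N x) P u l * nceval (N x) Q l v).
  by apply: class_sum => l _; exact: (class_mul HC).
by apply/funext => x; rewrite mxE.
Qed.

End function_class.

Section class_instances.
Context {R : realType}.

Lemma Ck_smooth_class k n : smooth_class (@Ck R k n).
Proof.
split=> [c|f g|f g|l f g /smoothP sf Cg]; [exact: Ck_cst|exact: CkD|exact: CkM|].
exact: Ck_comp.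
Qed.

Lemma continuous_smooth_class (X : topologicalType) (x : X) :
  smooth_class [set f : X -> R | {for x, continuous f}].
Proof.
split=> [c|f g cf cg|f g|l f g sf Cg] /=; first exact: cst_continuous.
- by have := continuousD cf cg.
- exact: continuous_mul.
apply: (@continuous_comp _ _ _ g f); last exact: (sf [::]).1.
by apply: continuous_mxP => i j; rewrite ord1; exact: Cg.
Qed.

Lemma differentiable_class (V : normedModType R) (x : V) :
  smooth_class [set f : V -> R | differentiable f x].
Proof.
split=> [c|f g df dg|f g df dg|l f g sf Cg] /=; first exact: differentiable_cst.
- exact: differentiableD.
- exact: differentiableM.
apply: (@differentiable_comp _ _ _ _ g f).
  exact: differentiable_col.
by have [+ _] := (smoothP f).1 sf 1; exact.
Qed.

Lemma differentiable_big_sum (V : normedModType R) (x : V) I (r : seq I)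
    (P : pred I) (f : I -> V -> R) : (forall i, P i -> differentiable (f i) x) ->
  differentiable (fun y => \sum_(i <- r | P i) f i y) x.
Proof.
exact: (@class_sum _ _ [set f : V -> R | differentiable f x]
  (differentiable_class x)).
Qed.

Lemma partialD n (g h : 'cV[R]_n -> R) i x : differentiable g x ->
  differentiable h x -> partial (fun y => g y + h y) i x = partial g i x + partial h i x.
Proof. by move=> dg dh; apply: deriveD; exact: diff_derivable. Qed.

Lemma partialZ n (g : 'cV[R]_n -> R) c i x : differentiable g x ->
  partial (fun y => c * g y) i x = c * partial g i x.
Proof. by move=> dg; apply: deriveZ; exact: diff_derivable. Qed.

Lemma partial_sum n I (r : seq I) (P : pred I) (g : I -> 'cV[R]_n -> R) i x :
  (forall j, differentiable (g j) x) ->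
  partial (fun y => \sum_(j <- r | P j) g j y) i x = \sum_(j <- r | P j) partial (g j) i x.
Proof.
move=> dg; elim: r => [|j r IH].
  rewrite big_nil (_ : (fun _ => _) = fun=> 0); first exact: derive_cst.
  by apply/funext => y; rewrite big_nil.
rewrite big_cons (_ : (fun _ => _) = if P j
    then (fun y => g j y + \sum_(j <- r | P j) g j y)
    else (fun y => \sum_(j <- r | P j) g j y)); last first.
  by apply/funext => y; rewrite big_cons; case: ifP.
case: ifP => // _; rewrite partialD ?IH//.
by apply: differentiable_big_sum => k _; exact: dg.
Qed.

Lemma partial_affine n (c : 'cV[R]_n -> R) I (r : seq I) (P : pred I)
    (w : I -> R) (g : I -> 'cV[R]_n -> R) t i x :
  differentiable c x -> (forall j, differentiable (g j) x) ->
  partial (fun y => c y + t * \sum_(j <- r | P j) w j * g j y) i x =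
  partial c i x + t * \sum_(j <- r | P j) w j * partial (g j) i x.
Proof.
move=> dc dg.
have dwg j : differentiable (fun y => w j * g j y) x by exact: differentiableZ.
have ds : differentiable (fun y => \sum_(j <- r | P j) w j * g j y) x.
  by apply: differentiable_big_sum => k _; exact: dwg.
rewrite partialD//; last exact: differentiableZ.
rewrite partialZ// partial_sum//; congr (_ + _ * _).
by apply: eq_bigr => j _; rewrite partialZ.
Qed.

End class_instances.

Section numerical_flow.
Context {R : realType} (s m : nat) (a : 'cV[R]_m -> 'cV[R]_m).
Context (L : 'M[R]_s) (b : 'cV[R]_s).
Hypothesis sa : smooth_field a.
Implicit Types (tau : R) (q : 'cV[R]_m).

Let f x := - a x.

Lemma smooth_field_opp : smooth_field f.
Proof.
apply/smooth_fieldP => k i.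
rewrite (_ : (fun _ => _) = fun x => - a x i 0); first exact/CkN/(smooth_fieldP a).1.
by apply/funext => x; rewrite mxE.
Qed.

Definition num_stages tau q : 'I_s -> 'cV[R]_m := rk_eval f L tau q s.

Definition num_flow tau q : 'cV[R]_m := rk_update b tau q (num_stages tau q).

Definition num_jac tau q (i : 'I_s) : 'M[R]_m :=
  tau *: stage_mx a L tau q (num_stages tau q) i.

Definition num_tangent tau q : 'M[R]_m :=
  1%:M + nceval (num_jac tau q) (rho_poly L b).

Lemma num_stages_spec tau q k : pos_stages a L tau q k <-> k = num_stages tau q.
Proof.
rewrite /pos_stages rk_stages_eval; split=> [e|->]; last by [].
exact/funext.
Qed.

Section classes.
Context (X : Type) (C : set (X -> R)) (tau : X -> R) (q : X -> 'cV[R]_m).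
Hypotheses (HC : smooth_class C) (Ctau : C tau) (Cq : forall i, C (fun x => q x i 0)).

Lemma class_num_flow r : C (fun x => num_flow (tau x) (q x) r 0).
Proof.
apply: class_rk_update; [exact: HC|exact: smooth_field_opp|exact: Ctau|exact: Cq].
Qed.

Lemma class_num_tangent u v : C (fun x => num_tangent (tau x) (q x) u v).
Proof.
rewrite (_ : (fun _ => _) = fun x => (1%:M : 'M[R]_m) u v +
  nceval (num_jac (tau x) (q x)) (rho_poly L b) u v); last first.
  by apply/funext => x; rewrite mxE.
apply: (class_add HC) => //; first exact: (class_cst HC).
apply: class_nceval => // i c r.
rewrite (_ : (fun _ => _) = fun x => tau x * partial (fun y => a y r 0) c
    (stage_point L (tau x) (q x) (num_stages (tau x) (q x)) i)); last first.
  by apply/funext => x; rewrite !mxE.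
apply: (class_mul HC) => //; apply: (class_comp HC); first exact/smooth_partial/sa.
move=> l; apply: class_stage_point => // j w.
apply: class_rk_eval; [exact: HC|exact: smooth_field_opp|exact: Ctau|exact: Cq].
Qed.

End classes.

Lemma num_flow_Ck tau k r : Ck k (fun q => num_flow tau q r 0).
Proof.
apply: (@class_num_flow _ (@Ck R k m) (fun=> tau) id).
- exact: Ck_smooth_class.
- exact: Ck_cst.
- exact: Ck_coord.
Qed.

Lemma num_stages_Ck tau k i r : Ck k (fun q => num_stages tau q i r 0).
Proof.
apply: (@class_rk_eval _ _ (@Ck R k m) _ _ _ _ _ (fun=> tau) id).
- exact: Ck_smooth_class.
- exact: smooth_field_opp.
- exact: Ck_cst.
- exact: Ck_coord.
Qed.

(** Differentiating the recursion of the stages gives the recursion of tangent;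
    the indices are exchanged because the latter is transposed. *)
Lemma num_stages_partial tau q i r c :
  tau * partial (fun x => num_stages tau x i r 0) c q =
  tangent L (num_jac tau q) i c r.
Proof.
have dk j l x : differentiable (fun x => num_stages tau x j l 0) x.
  by have [+ _] := num_stages_Ck tau 1 j l; exact.
have [n ni] := ubnP (i : nat); elim: n => [//|n IH] in i r c ni *.
pose Q x := stage_point L tau x (num_stages tau x) i.
have kE : (fun x => num_stages tau x i r 0) = (fun x => - 1 * a (Q x) r 0).
  apply/funext => x; rewrite /num_stages (rk_eval_stages f) ?ltn_ord//.
  by rewrite mxE mulN1r.
have QE l : (fun x => Q x l 0) = (fun x : 'cV[R]_m => x l 0 +
    tau * \sum_(j < s | (j < i)%N) L i j * num_stages tau x j l 0).
  apply/funext => x; rewrite !mxE summxE; congr (_ + _ * _).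
  by apply: eq_bigr => j _; rewrite mxE.
have dQ l : differentiable (fun x => Q x l 0) q.
  have [+ _] : Ck 1 (fun x => Q x l 0); last exact.
  apply: (@class_stage_point _ _ _ (Ck_smooth_class 1 m) _ _ L (fun=> tau) id).
  - exact: Ck_cst.
  - exact: Ck_coord.
  - by move=> j u; exact: num_stages_Ck.
have da x : differentiable (fun y => a y r 0) x.
  by have [+ _] := (smooth_fieldP a).1 sa 1 r; exact.
have daQ : differentiable (fun x => a (Q x) r 0) q.
  apply: (@differentiable_comp _ _ _ _ Q (fun y => a y r 0)).
    exact: differentiable_col dQ.
  exact: da.
rewrite kE partialZ// (@partial_comp _ _ _ (fun y => a y r 0) Q)//.
rewrite tangentE mulNmx 2!mxE mulN1r mulrN; congr (- _).
rewrite mulr_sumr; apply: eq_bigr => l _.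
rewrite mulrA [RHS]mulrC; congr (_ * _); first by rewrite !mxE.
rewrite QE partial_affine//; last exact: differentiable_coord.
rewrite partial_coord !mxE summxE [c == l]eq_sym; congr (_ + _).
rewrite mulr_sumr; apply: eq_bigr => j ji; rewrite mulrCA mxE IH//.
exact: leq_trans ji _.
Qed.

Lemma num_flow_partial tau q r c :
  partial (fun x => num_flow tau x r 0) c q = num_tangent tau q c r.
Proof.
rewrite (_ : (fun x => num_flow tau x r 0) = fun x : 'cV[R]_m => x r 0 +
   tau * \sum_i b i 0 * num_stages tau x i r 0); last first.
  apply/funext => x; rewrite !mxE summxE; congr (_ + _ * _).
  by apply: eq_bigr => j _; rewrite mxE.
rewrite partial_affine; first last.
- by move=> j; have [+ _] := num_stages_Ck tau 1 j r; exact.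
- exact: differentiable_coord.
rewrite partial_coord /num_tangent rho_polyE !mxE summxE [r == c]eq_sym; congr (_ + _).
rewrite mulr_sumr; apply: eq_bigr => j _.
by rewrite mulrCA num_stages_partial mxE.
Qed.

End numerical_flow.

(** * One step as a cotangent lift *)

Section block_coordinates.
Context {R : realType} (m1 m2 : nat).
Implicit Types z : 'cV[R]_(m1 + m2).

Lemma usubmx_delta_lshift c :
  usubmx (delta_mx (lshift m2 c) 0 : 'cV[R]_(m1 + m2)) = delta_mx c 0.
Proof. by apply/colP => i; rewrite !mxE eq_lshift. Qed.

Lemma usubmx_delta_rshift c :
  usubmx (delta_mx (rshift m1 c) 0 : 'cV[R]_(m1 + m2)) = 0.
Proof. by apply/colP => i; rewrite !mxE eq_lrshift. Qed.

Lemma partial_usubmx_lshift (g : 'cV[R]_m1 -> R) c z :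
  partial (fun z => g (usubmx z)) (lshift m2 c) z = partial g c (usubmx z).
Proof.
rewrite /partial [LHS]derive_line0 [RHS]derive_line0.
rewrite (_ : (fun h : R => g (usubmx _)) =
  (fun h => g (h *: delta_mx c 0 + usubmx z))) //.
by apply/funext => h; rewrite linearP /= usubmx_delta_lshift.
Qed.

Lemma partial_usubmx_rshift (g : 'cV[R]_m1 -> R) c z :
  partial (fun z => g (usubmx z)) (rshift m1 c) z = 0.
Proof.
rewrite /partial [LHS]derive_line0 (_ : (fun h => _) = cst (g (usubmx z))).
  exact: derive_cst.
by apply/funext => h; rewrite linearP /= usubmx_delta_rshift scaler0 add0r.
Qed.

Lemma dsubmx_coordE i :
  (fun z => dsubmx z i 0) = (fun z => z (rshift m1 i) 0).
Proof. by apply/funext => z; rewrite mxE. Qed.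

Lemma usubmx_coordE i :
  (fun z => usubmx z i 0) = (fun z => z (lshift m2 i) 0).
Proof. by apply/funext => z; rewrite mxE. Qed.

Lemma partial_dsubmx_lshift i c z :
  partial (fun z => dsubmx z i 0) (lshift m2 c) z = 0.
Proof. by rewrite dsubmx_coordE partial_coord eq_rlshift. Qed.

Lemma partial_dsubmx_rshift i c z :
  partial (fun z => dsubmx z i 0) (rshift m1 c) z = (i == c)%:R.
Proof. by rewrite dsubmx_coordE partial_coord eq_rshift. Qed.

Lemma differentiable_usubmx z : differentiable (@usubmx R m1 m2 1) z.
Proof.
apply: differentiable_col => i; rewrite usubmx_coordE.
exact: differentiable_coord.
Qed.

Lemma differentiable_dsubmx_coord i z : differentiable (fun z => dsubmx z i 0) z.
Proof. by rewrite dsubmx_coordE; exact: differentiable_coord. Qed.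

End block_coordinates.

Lemma block_symplectic (R : realType) m (B S W : 'M[R]_m) :
  B *m W = 1%:M -> (B *m S)^T = B *m S ->
  (block_mx B^T 0 S W)^T *m symplectic_mx R m *m block_mx B^T 0 S W
  = symplectic_mx R m.
Proof.
move=> BW BS; rewrite /symplectic_mx tr_block_mx trmxK trmx0 !mulmx_block.
rewrite !mulmx0 !mul0mx !mulmx1 !mulmxN !mulmx1 !add0r !addr0 !mulNmx !mul0mx.
rewrite BW ?oppr0 ?addr0 ?add0r -!trmx_mul BS BW trmx1 addrC subrr.
by [].
Qed.

Section one_step.
Context {R : realType} (s m : nat) (a : 'cV[R]_m -> 'cV[R]_m).
Context (L : 'M[R]_s) (b : 'cV[R]_s).
Hypothesis sa : smooth_field a.
Hypotheses (L_lower : strictly_lower L) (b_neq0 : forall i, b i 0 != 0).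
Context (tau : R).
Implicit Types (z w : 'cV[R]_(m + m)) (q : 'cV[R]_m).

Local Notation Lh := (symplectic_companion L b).
Local Notation B := (num_tangent a L b tau).
Local Notation Psi := (num_flow a L b tau).

Lemma num_tangent_momentum q :
  B q = momentum_mx L b tau (stage_mx a L tau q (num_stages a L tau q)).
Proof. by rewrite /num_tangent rho_polyE. Qed.

Lemma step_well_defined z : B (usubmx z) \in unitmx -> prk_well_defined a L Lh tau z.
Proof.
move=> U k /(num_stages_spec a) ->.
by apply: momentum_stages_unique => //; rewrite -num_tangent_momentum.
Qed.

Lemma step_momentum z l : B (usubmx z) \in unitmx ->
  mom_stages a L Lh tau (usubmx z) (dsubmx z) (num_stages a L tau (usubmx z)) l ->
  rk_update b tau (dsubmx z) l = invmx (B (usubmx z)) *m dsubmx z.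
Proof.
move=> U lE; pose M := stage_mx a L tau (usubmx z) (num_stages a L tau (usubmx z)).
have : B (usubmx z) *m rk_update b tau (dsubmx z) l = dsubmx z.
  rewrite num_tangent_momentum; apply: momentum_conservation => // i.
  by rewrite -companion_backward//; exact: lE.
by move=> {2}<-; rewrite mulKmx.
Qed.

Lemma step_explicit z : B (usubmx z) \in unitmx ->
  prk_explicit a L Lh b tau (rho_poly L b) z.
Proof.
move=> U; split=> [k|k l /(num_stages_spec a) -> lE]; first exact: rk_stages_eval.
by split; [exact: U|exact: step_momentum].
Qed.

Lemma step_iff z w : B (usubmx z) \in unitmx ->
  prk_step a L Lh b tau z w <->
  w = col_mx (Psi (usubmx z)) (invmx (B (usubmx z)) *m dsubmx z).
Proof.
move=> U; split=> [[k [l [/(num_stages_spec a) -> lE ->]]]|->].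
  by rewrite (step_momentum U lE).
have ks : pos_stages a L tau (usubmx z) (num_stages a L tau (usubmx z)).
  exact/(num_stages_spec a).
have [l [lE _]] := step_well_defined U ks.
exists (num_stages a L tau (usubmx z)), l; split=> //.
by rewrite (step_momentum U lE).
Qed.

(** The step map (q, p) |-> (Psi q, B(q)^-1 p), where B(q) is the transposed
    derivative of Psi. The inverse is spelled out by Cramer's rule, an algebraic
    expression in the entries that can be differentiated wherever the determinant
    does not vanish. *)
Definition cotangent_lift z : 'cV[R]_(m + m) :=
  col_mx (Psi (usubmx z))
    ((\det (B (usubmx z)))^-1 *: (\adj (B (usubmx z)) *m dsubmx z)).

Lemma cotangent_liftE z : B (usubmx z) \in unitmx ->
  cotangent_lift z = col_mx (Psi (usubmx z)) (invmx (B (usubmx z)) *m dsubmx z).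
Proof. by move=> U; rewrite /cotangent_lift /invmx U scalemxAl. Qed.

Lemma num_tangent_differentiable u v z :
  differentiable (fun z : 'cV[R]_(m + m) => B (usubmx z) u v) z.
Proof.
apply: (@differentiable_comp _ _ _ _ (@usubmx R m m 1) (fun q => B q u v)).
  exact: differentiable_usubmx.
rewrite (_ : (fun q => B q u v) = partial (fun q => Psi q v 0) u).
  by have [_ /(_ u)[+ _]] := num_flow_Ck L b sa tau 2 v; exact.
by apply/funext => q; rewrite num_flow_partial.
Qed.

Section at_point.
Context (z : 'cV[R]_(m + m)) (U : B (usubmx z) \in unitmx).

Let det_neq0 : \det (B (usubmx z)) != 0.
Proof. by rewrite -unitfE -unitmxE. Qed.

Let det_differentiable : differentiable (fun z => \det (B (usubmx z))) z.
Proof.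
apply: (@class_det _ _ [set f : 'cV[R]_(m + m) -> R | differentiable f z]).
  exact: differentiable_class.
by move=> i j; exact: num_tangent_differentiable.
Qed.

Lemma num_tangent_unit_near : \forall z' \near z, B (usubmx z') \in unitmx.
Proof.
have := differentiable_continuous det_differentiable.
move=> /(@cvgr_neq0 _ _ _ (nbhs z)) /(_ det_neq0).
by apply: filterS => z' ?; rewrite unitmxE unitfE.
Qed.

Let r i (z' : 'cV[R]_(m + m)) : R := (\det (B (usubmx z')))^-1 *
  \sum_j (\adj (B (usubmx z'))) i j * dsubmx z' j 0.

Let liftE i : (fun z' => cotangent_lift z' (rshift m i) 0) = r i.
Proof. by apply/funext => z'; rewrite /cotangent_lift col_mxEd !mxE. Qed.

Let r_differentiable i : differentiable (r i) z.
Proof.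
apply: differentiableM; first exact: differentiableV.
apply: differentiable_big_sum => j _; apply: differentiableM.
  apply: (@class_adj _ _ [set f : 'cV[R]_(m + m) -> R | differentiable f z]).
    exact: differentiable_class.
  by move=> u v; exact: num_tangent_differentiable.
exact: differentiable_dsubmx_coord.
Qed.

Lemma cotangent_lift_differentiable : differentiable cotangent_lift z.
Proof.
apply: differentiable_col => j; case: (split_ordP j) => i ->.
  rewrite (_ : (fun y => _) = fun y => Psi (usubmx y) i 0).
    apply: (@differentiable_comp _ _ _ _ (@usubmx R m m 1) (fun q => Psi q i 0)).
      exact: differentiable_usubmx.
    by have [+ _] := num_flow_Ck L b sa tau 1 i; exact.
  by apply/funext => y; rewrite /cotangent_lift col_mxEu.
by rewrite liftE; exact: r_differentiable.
Qed.

Let momentum_near i :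
  \forall z' \near z, \sum_l B (usubmx z') i l * r l z' = dsubmx z' i 0.
Proof.
have := num_tangent_unit_near; apply: filterS => z' U'.
have : B (usubmx z') *m (invmx (B (usubmx z')) *m dsubmx z') = dsubmx z'.
  by rewrite mulKVmx.
rewrite /invmx U' => /(congr1 (fun v : 'cV[R]_m => v i 0)) <-.
rewrite [RHS]mxE; apply: eq_bigr => l _; congr (_ * _).
rewrite -[r l z'](congr1 (fun f => f z') (liftE l)).
by rewrite /cotangent_lift col_mxEd scalemxAl.
Qed.

Let momentum_partial i c :
  \sum_l (B (usubmx z) i l * partial (r l) c z +
          r l z * partial (fun z => B (usubmx z) i l) c z)
  = partial (fun z : 'cV[R]_(m + m) => dsubmx z i 0) c z.
Proof.
rewrite -[RHS](near_eq_derive _ (momentum_near i)).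
rewrite -[RHS]/(partial (fun z' => \sum_l B (usubmx z') i l * r l z') c z).
rewrite partial_sum; last first.
  by move=> l; apply: differentiableM => //; exact: num_tangent_differentiable.
apply: eq_bigr => l _; rewrite [RHS]deriveM//; apply: diff_derivable => //.
exact: num_tangent_differentiable.
Qed.

(** The differential of the lift is [[B^T, 0], [S, B^-1]]. Differentiating
    B r = p in the positions expresses B S by second derivatives of the position
    map, so that B S is symmetric; this is all that symplecticity requires. *)
Lemma cotangent_lift_symplectic :
  (jacobi cotangent_lift z)^T *m symplectic_mx R m *m jacobi cotangent_lift z
  = symplectic_mx R m.
Proof.
pose S : 'M[R]_m := \matrix_(i, c) partial (r i) (lshift m c) z.
pose W : 'M[R]_m := \matrix_(i, c) partial (r i) (rshift m c) z.
set Bz := B (usubmx z).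
have SE i c : S i c = partial (r i) (lshift m c) z by rewrite /S mxE.
have WE i c : W i c = partial (r i) (rshift m c) z by rewrite /W mxE.
have JE : jacobi cotangent_lift z = block_mx Bz^T 0 S W.
  apply/matrixP => i' c'; rewrite [LHS]mxE.
  case: (split_ordP i') => i ->; last first.
    rewrite liftE; case: (split_ordP c') => c ->.
      by rewrite block_mxEdl SE.
    by rewrite block_mxEdr WE.
  rewrite (_ : (fun y => _) = fun y => (fun q => Psi q i 0) (usubmx y)); last first.
    by apply/funext => y; rewrite /cotangent_lift col_mxEu.
  case: (split_ordP c') => c ->.
    by rewrite block_mxEul (@partial_usubmx_lshift _ _ _ (fun q => Psi q i 0))
      num_flow_partial// [RHS]mxE.
  by rewrite block_mxEur (@partial_usubmx_rshift _ _ _ (fun q => Psi q i 0)) mxE.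
have BW : Bz *m W = 1%:M.
  apply/matrixP => i c; rewrite [LHS]mxE [RHS]mxE -(partial_dsubmx_rshift i c z) -momentum_partial.
  apply: eq_bigr => l _.
  by rewrite (@partial_usubmx_rshift _ _ _ (fun q => B q i l)) mulr0 addr0 WE.
have BS : (Bz *m S)^T = Bz *m S.
  have E i c : (Bz *m S) i c =
      - \sum_l r l z * partial (partial (fun q => Psi q l 0) i) c (usubmx z).
    have H := momentum_partial i (lshift m c).
    rewrite partial_dsubmx_lshift big_split /= in H.
    have E1 : \sum_l Bz i l * partial (r l) (lshift m c) z = (Bz *m S) i c.
      by rewrite [RHS]mxE; apply: eq_bigr => l _; rewrite SE.
    have E2 l : partial (fun z => B (usubmx z) i l) (lshift m c) z =
        partial (partial (fun q => Psi q l 0) i) c (usubmx z).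
      rewrite (@partial_usubmx_lshift _ _ _ (fun q => B q i l)).
      rewrite (_ : (fun q => B q i l) = partial (fun q => Psi q l 0) i)//.
      by apply/funext => q; rewrite num_flow_partial.
    rewrite E1 in H; apply/eqP; rewrite -addr_eq0 -[X in _ == X]H; apply/eqP.
    by congr (_ + _); apply: eq_bigr => l _; rewrite E2.
  have Es i c : \sum_l r l z * partial (partial (fun q => Psi q l 0) i) c (usubmx z)
      = \sum_l r l z * partial (partial (fun q => Psi q l 0) c) i (usubmx z).
    apply: eq_bigr => l _.
    exact: (congr1 ( *%R (r l z))
      (partial_symmetry i c (usubmx z) (num_flow_Ck L b sa tau 2 l))).
  apply/matrixP => i c; rewrite [LHS]mxE.
  exact: (etrans (E c i) (etrans (congr1 -%R (Es c i)) (esym (E i c)))).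
by rewrite JE; exact: block_symplectic.
Qed.

End at_point.

Lemma step_symplectic z : B (usubmx z) \in unitmx ->
  prk_symplectic a L Lh b tau z.
Proof.
move=> U; exists cotangent_lift; split.
- have := num_tangent_unit_near U; apply: filterS => z' U' w.
  by rewrite (cotangent_liftE U'); exact: step_iff.
- exact: cotangent_lift_differentiable.
- exact: cotangent_lift_symplectic.
Qed.

End one_step.

(** * Bounds on compact sets *)

Section compactness.
Context {R : realType}.

Lemma compact_norm_bound (X : topologicalType) (A : set X) m n
    (f : X -> 'M[R]_(m, n)) :
  compact A -> (forall x i j, A x -> {for x, continuous (fun y => f y i j)}) ->
  exists2 M, 0 <= M & forall x, A x -> `|f x| <= M.
Proof.
move=> /compact_near_coveringP cA cf.
have : \forall M \near +oo, A `<=` (fun x => `|f x| <= M).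
  apply: (cA _ (pinfty_nbhs R) (fun M x => `|f x| <= M)) => x Ax.
  have cx : {for x, continuous f} by apply: continuous_mxP => i j; exact: cf.
  have cn : `|f y| @[y --> x] --> `|f x| by exact: cvg_norm cx.
  exists ([set y | `|f y| < `|f x| + 1], [set M | `|f x| + 1 <= M]) => /=.
    split; last exact: nbhs_pinfty_ge.
    by apply: (cvgr_lt _ cn); rewrite ltrDl.
  by move=> [y M] /= [] h1 h2; exact: le_trans (ltW h1) h2.
move=> /(filterI (nbhs_pinfty_ge (num_real (0 : R)))) /filter_ex[M [M0 AM]].
by exists M.
Qed.

Lemma compact_tube (X : topologicalType) (A : set X) (f : R * X -> R) :
  compact A -> (forall x, A x -> {for (0, x), continuous f}) ->
  (forall x, A x -> f (0, x) != 0) ->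
  exists2 e, 0 < e & forall t x, 0 <= t <= e -> A x -> f (t, x) != 0.
Proof.
move=> /compact_near_coveringP cA cf f0.
have : \forall t \near (0 : R), A `<=` (fun x => f (t, x) != 0).
  apply: (cA _ (nbhs (0 : R)) (fun t x => f (t, x) != 0)) => x Ax.
  have [[U V] /= [U0 Vx] UV] : \forall y \near (0 : R, x), f y != 0.
    have := cf x Ax => /(@cvgr_neq0 _ _ _ (nbhs (0 : R, x))).
    by move=> /(_ (f0 x Ax)).
  by exists (V, U) => //= -[y t] /= [Vy Ut]; exact: (UV (t, y)).
move=> /nbhs_ballP[e /= e0 He]; exists (e / 2); first by rewrite divr_gt0.
move=> t x /andP[t0 te] Ax; apply: He => //.
rewrite -ball_normE /= sub0r normrN ger0_norm// (le_lt_trans te)//.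
by rewrite ltr_pdivrMr// mulr_natr mulr2n ltrDl.
Qed.

Lemma ball_compact n (r : R) : 0 <= r -> compact [set v : 'cV[R]_n | `|v| <= r].
Proof.
move=> r0; rewrite (_ : [set _ | _] =
  trmx @` [set v : 'rV[R]_n | forall i, `[- r, r]%classic (v ord0 i)]).
  apply: continuous_compact; last first.
    apply: (@rV_compact _ _ (fun=> `[- r, r]%classic)).
    by move=> _; apply: segment_compact.
  apply: continuous_subspaceT => v; apply: continuous_mxP => i j.
  rewrite (_ : (fun y => _) = fun y : 'rV[R]_n => y j i).
    exact: coord_continuous.
  by apply/funext => y; rewrite mxE.
apply/seteqP; split=> [v /= vr|_ [v /= vr <-]].
  exists v^T; last by rewrite trmxK.
  move=> i; rewrite mxE /= in_itv /= -ler_norml.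
  exact: le_trans (coord_le_norm _ _ _) vr.
apply: norm_le_coord => // i j; rewrite mxE ord1.
by have := vr i; rewrite /= in_itv /= -ler_norml.
Qed.

Lemma norm_mulmx_le m n p (A : 'M[R]_(m, n)) (v : 'M[R]_(n, p)) :
  `|A *m v| <= n%:R * `|A| * `|v|.
Proof.
apply: norm_le_coord => [|i j]; first by rewrite !mulr_ge0.
rewrite mxE (le_trans (ler_norm_sum _ _ _))//.
apply: (@le_trans _ _ (\sum_(k < n) `|A| * `|v|)).
  by apply: ler_sum => k _; rewrite normrM ler_pM// coord_le_norm.
by rewrite sumr_const card_ord -[X in X <= _]mulr_natl mulrA.
Qed.

Lemma norm_col_mx_le m1 m2 (u : 'cV[R]_m1) (v : 'cV[R]_m2) e :
  0 <= e -> `|u| <= e -> `|v| <= e -> `|col_mx u v| <= e.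
Proof.
move=> e0 ue ve; apply: norm_le_coord => // i j; rewrite ord1.
case: (split_ordP i) => k ->.
  by rewrite col_mxEu (le_trans (coord_le_norm _ _ _)).
by rewrite col_mxEd (le_trans (coord_le_norm _ _ _)).
Qed.

Lemma norm_usubmx_le m1 m2 (z : 'cV[R]_(m1 + m2)) : `|usubmx z| <= `|z|.
Proof. by apply: norm_le_coord => // i j; rewrite mxE coord_le_norm. Qed.

Lemma norm_dsubmx_le m1 m2 (z : 'cV[R]_(m1 + m2)) : `|dsubmx z| <= `|z|.
Proof. by apply: norm_le_coord => // i j; rewrite mxE coord_le_norm. Qed.

End compactness.

(** * Local error *)

Section linearized_method.
Context {R : realType} (s m : nat) (a : 'cV[R]_m -> 'cV[R]_m).
Context (L : 'M[R]_s) (b : 'cV[R]_s).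
Hypothesis sa : smooth_field a.

(** The position equation together with its linearization; the Runge-Kutta
    method applied to this system computes the position update together with the
    derivative of that update in the direction given by the second component. *)
Definition linearized_field (x : 'cV[R]_(m + m)) : 'cV[R]_(m + m) :=
  col_mx (- a (usubmx x)) (- jacobi a (usubmx x) *m dsubmx x).

Lemma Ck_usubmx k i : Ck k (fun z : 'cV[R]_(m + m) => usubmx z i 0).
Proof. by rewrite usubmx_coordE; exact: Ck_coord. Qed.

Lemma Ck_dsubmx k i : Ck k (fun z : 'cV[R]_(m + m) => dsubmx z i 0).
Proof. by rewrite dsubmx_coordE; exact: Ck_coord. Qed.

Lemma Ck_jacobi_usubmx k i j :
  Ck k (fun z : 'cV[R]_(m + m) => jacobi a (usubmx z) i j).
Proof.
rewrite (_ : (fun z => _) = fun z : 'cV[R]_(m + m) =>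
   partial (fun y => a y i 0) j (usubmx z)); last first.
  by apply/funext => z; rewrite mxE.
apply: Ck_comp; last exact: Ck_usubmx.
by move: k; apply/smoothP/smooth_partial/sa.
Qed.

Lemma Ck_opp_usubmx k i : Ck k (fun z : 'cV[R]_(m + m) => (- a (usubmx z)) i 0).
Proof.
apply: (@Ck_comp _ k _ _ (fun x => (- a x) i 0)); last exact: Ck_usubmx.
by apply: (smooth_fieldP _).1; exact: smooth_field_opp.
Qed.

Lemma linearized_field_smooth : smooth_field linearized_field.
Proof.
apply/smooth_fieldP => k; apply: Ck_col_mx => i; first exact: Ck_opp_usubmx.
rewrite (_ : (fun z => _) = fun z : 'cV[R]_(m + m) =>
  \sum_j (- jacobi a (usubmx z) i j) * dsubmx z j 0); last first.
  by apply/funext => z; rewrite mxE; apply: eq_bigr => j _; rewrite mxE.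
apply: Ck_sum => j _; apply: CkM; last exact: Ck_dsubmx.
by apply: CkN; exact: Ck_jacobi_usubmx.
Qed.

Lemma magnetic_field_continuous i :
  continuous (fun z => magnetic_field a z i 0).
Proof.
apply: (@Ck_col_mx _ 0); first exact: Ck_opp_usubmx.
move=> {}i; rewrite (_ : (fun z => _) = fun z : 'cV[R]_(m + m) =>
  \sum_j jacobi a (usubmx z) j i * dsubmx z j 0); last first.
  by apply/funext => z; rewrite mxE; apply: eq_bigr => j _; rewrite mxE.
apply: Ck_sum => j _; apply: CkM; last exact: Ck_dsubmx.
exact: Ck_jacobi_usubmx.
Qed.

Lemma linearized_stages tau q (d0 : 'cV[R]_m) : tau != 0 ->
  let E i := tangent L (num_jac a L tau q) i in
  let k i := col_mx (num_stages a L tau q i) (tau^-1 *: ((E i)^T *m d0)) in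
  rk_stages linearized_field L tau (col_mx q d0) k /\
  rk_update b tau (col_mx q d0) k =
    col_mx (num_flow a L b tau q) ((num_tangent a L b tau q)^T *m d0).
Proof.
move=> t0 E k.
have sumE (P : pred 'I_s) (c : 'I_s -> R) :
    tau *: (\sum_(j | P j) c j *: k j) =
    col_mx (tau *: \sum_(j | P j) c j *: num_stages a L tau q j)
           ((\sum_(j | P j) c j *: E j)^T *m d0).
  apply/colP => i; case: (split_ordP i) => r ->.
    rewrite col_mxEu [LHS]mxE [RHS]mxE !summxE; congr (_ * _).
    by apply: eq_bigr => j _; rewrite [LHS]mxE [RHS]mxE /k col_mxEu.
  have trE : ((\sum_(j | P j) c j *: E j)^T *m d0) r 0 =
      \sum_(j | P j) c j * ((E j)^T *m d0) r 0.
    have -> : (\sum_(j | P j) c j *: E j)^T = \sum_(j | P j) c j *: (E j)^T.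
      apply/matrixP => u v; rewrite mxE !summxE; apply: eq_bigr => j _.
      by rewrite [LHS]mxE [RHS]mxE [X in _ = _ * X]mxE.
    by rewrite mulmx_suml summxE; apply: eq_bigr => j _; rewrite -scalemxAl mxE.
  rewrite col_mxEd trE [LHS]mxE summxE mulr_sumr; apply: eq_bigr => j _.
  rewrite [(c j *: k j) _ _]mxE /k col_mxEd [X in _ * (_ * X)]mxE.
  by rewrite mulrCA [tau * _]mulrA mulfV// mul1r.
have one : d0 = (1%:M : 'M[R]_m)^T *m d0 by rewrite trmx1 mul1mx.
split; last first.
  rewrite /rk_update sumE add_col_mx; congr col_mx.
  by rewrite {1}one -mulmxDl -raddfD /num_tangent rho_polyE.
move=> i; rewrite /stage_point sumE add_col_mx.
rewrite [X in col_mx _ (X + _)]one -mulmxDl -raddfD.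
rewrite /linearized_field col_mxKu col_mxKd /k; congr col_mx.
  by rewrite /num_stages rk_eval_stages ?ltn_ord.
rewrite /E tangentE mulNmx raddfN /= trmx_mul /num_jac /stage_mx.
rewrite linearZ /= trmxK mulNmx scalerN -!scalemxAl scalerA mulVf// scale1r.
by rewrite mulNmx mulmxA.
Qed.

End linearized_method.

Section local_error.
Context {R : realType} (s m : nat) (a : 'cV[R]_m -> 'cV[R]_m).
Context (L : 'M[R]_s) (b : 'cV[R]_s).
Hypothesis sa : smooth_field a.
Hypotheses (L_lower : strictly_lower L) (b_neq0 : forall i, b i 0 != 0).
Context (K : set 'cV[R]_(m + m)) (K_compact : compact K).
Context (rho speed tau0 : R).
Hypotheses (rho_ge0 : 0 <= rho) (K_rho : forall z, K z -> `|z| <= rho).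
Hypotheses (speed_ge0 : 0 <= speed)
  (field_speed : forall z, `|z| <= rho + 1 -> `|magnetic_field a z| <= speed).
Hypotheses (tau0_gt0 : 0 < tau0) (tau0_speed : speed * tau0 < 1).
Hypothesis tangent_unit : forall tau z, 0 <= tau <= tau0 -> K z ->
  num_tangent a L b tau (usubmx z) \in unitmx.

Local Notation Lh := (symplectic_companion L b).

Lemma solution_bounded tau (y : R -> 'cV[R]_(m + m)) t :
  tau <= tau0 -> K (y 0) -> is_solution (magnetic_field a) tau y ->
  0 <= t <= tau -> `|y t| <= rho + 1.
Proof.
move=> tt0 Ky ysol ttau.
have st : speed * tau < 1 by apply: le_lt_trans tau0_speed; rewrite ler_wpM2l.
have near0 x : `|x - y 0| <= 1 -> `|x| <= rho + 1.
  move=> h; rewrite -(subrK (y 0) x) addrC (le_trans (ler_normD _ _))// lerD//.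
  exact: K_rho.
apply/near0/(solution_stays speed_ge0 st ysol _ ttau) => x /near0.
exact: field_speed.
Qed.

Lemma numerical_bounds : exists CP CI : R, [/\ 0 <= CP, 0 <= CI &
  forall tau z, 0 <= tau <= tau0 -> K z ->
    `|num_flow a L b tau (usubmx z)| <= CP /\
    `|invmx (num_tangent a L b tau (usubmx z))| <= CI].
Proof.
pose X := (R * 'cV[R]_(m + m))%type.
pose A : set X := `[0, tau0]%classic `*` K.
have cA : compact A by apply: compact_setX => //; exact: segment_compact.
pose q (x : X) := usubmx x.2.
have C1 (x : X) : {for x, continuous (fun y : X => y.1)} by exact: cvg_fst.
have Cq (x : X) i : {for x, continuous (fun y : X => q y i 0)}.
  apply: (@continuous_comp _ _ _ snd (fun z => usubmx z i 0)); first exact: cvg_snd.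
  by have := @Ck_usubmx R m 0 i; exact.
pose C (x : X) := [set f : X -> R | {for x, continuous f}].
have HC (x : X) : smooth_class (C x) := continuous_smooth_class x.
have CB (x : X) u v : {for x, continuous (fun y : X => num_tangent a L b y.1 (q y) u v)}.
  exact: (class_num_tangent L b sa (HC x) (C1 x) (Cq x)).
have Au (x : X) : A x -> num_tangent a L b x.1 (q x) \in unitmx.
  by move=> [/= + Kx]; rewrite in_itv /= => xt; exact: tangent_unit.
have [|CP CP0 HP] := @compact_norm_bound R X A m 1 (fun x => num_flow a L b x.1 (q x)) cA.
  move=> x i j _; rewrite ord1.
  exact: (class_num_flow L b sa (HC x) (C1 x) (Cq x)).
have [|CI CI0 HI] := @compact_norm_bound R X A m m (fun x =>
   (\det (num_tangent a L b x.1 (q x)))^-1 *: \adj (num_tangent a L b x.1 (q x))) cA.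
  move=> x i j /Au U.
  rewrite (_ : (fun y => _) = fun y : X => (\det (num_tangent a L b y.1 (q y)))^-1 *
    (\adj (num_tangent a L b y.1 (q y))) i j); last first.
    by apply/funext => y; rewrite mxE.
  apply: continuous_mul; last exact: (class_adj (HC x) _ _ (CB x)).
  have := @class_det _ _ (C x) (HC x) _ _ (CB x).
  by apply: cvgV; rewrite -unitfE -unitmxE.
exists CP, CI; split=> // tau z tt Kz.
have Az : A (tau, z) by split=> //=; rewrite in_itv.
split; first exact: (HP _ Az).
by have := HI _ Az; rewrite /= /invmx (Au _ Az).
Qed.

Section along_solution.
Context (nu : nat) (C1 tau1 jac : R).
Hypothesis jac_ge0 : 0 <= jac.
Hypothesis jac_bound : forall z : 'cV[R]_(m + m), `|z| <= rho + 1 ->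
  `|jacobi a (usubmx z)| <= jac.
Let KL : set 'cV[R]_(m + m) :=
  (fun x : 'cV[R]_(m + m) * 'cV[R]_m => col_mx (usubmx x.1) x.2) @`
    (K `*` [set v | `|v| <= 1]).
Hypothesis order_linearized : forall tau (y : R -> 'cV[R]_(m + m))
    (k : 'I_s -> 'cV[R]_(m + m)),
  0 < tau <= tau1 -> KL (y 0) -> is_solution (linearized_field a) tau y ->
  rk_stages (linearized_field a) L tau (y 0) k ->
  `|y tau - rk_update b tau (y 0) k| <= C1 * tau ^+ nu.+1.

Context (tau : R) (y : R -> 'cV[R]_(m + m)).
Hypotheses (tau_gt0 : 0 < tau) (tau_le0 : tau <= tau0) (tau_le1 : tau <= tau1).
Hypothesis tau_jac : m%:R * jac * tau <= 2^-1.
Hypotheses (Ky : K (y 0)) (ysol : is_solution (magnetic_field a) tau y).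

Let q0 := usubmx (y 0).
Let Bt := num_tangent a L b tau q0.

(** The position part of the given solution is completed to a solution of the
    linearized system, to which the assumption on the order applies. *)
Lemma linearized_error (d0 : 'cV[R]_m) : `|d0| <= 1 -> exists d : R -> 'cV[R]_m,
  [/\ d 0 = d0,
   forall t, 0 <= t <= tau ->
     is_derive t (1 : R) d (- jacobi a (usubmx (y t)) *m d t) &
   `|col_mx (usubmx (y tau)) (d tau) -
     col_mx (num_flow a L b tau q0) (Bt^T *m d0)| <= C1 * tau ^+ nu.+1].
Proof.
move=> d01.
have [||d [d0E dd]] := @linear_ode_exists R m (fun t => - jacobi a (usubmx (y t)))
   (m%:R * jac) tau d0 (ltW tau_gt0) (mulr_ge0 (ler0n _ _) jac_ge0) tau_jac.
- move=> t i j ttau.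
  have yc : {for t, continuous y} := is_derive_continuous (ysol ttau).
  have jc : {for t, continuous (fun t => jacobi a (usubmx (y t)) i j)}.
    apply: (@continuous_comp _ _ _ y (fun z => jacobi a (usubmx z) i j)) => //.
    by have := Ck_jacobi_usubmx sa 0 i j; exact.
  rewrite (_ : (fun t => _) = fun t => - jacobi a (usubmx (y t)) i j).
    exact: cvgN jc.
  by apply/funext => u; rewrite mxE.
- move=> t v ttau; rewrite (le_trans (norm_mulmx_le _ _))// ler_wpM2r//.
  by rewrite ler_wpM2l// normrN jac_bound// (solution_bounded tau_le0).
exists d; split=> //.
pose yL t := col_mx (usubmx (y t)) (d t).
have yL0 : yL 0 = col_mx q0 d0 by rewrite /yL d0E.
have yLsol : is_solution (linearized_field a) tau yL.
  move=> t ttau; apply: is_derive_col => i; case: (split_ordP i) => k ->.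
    rewrite (_ : (fun s => _) = fun s => y s (lshift m k) 0); last first.
      by apply/funext => u; rewrite /yL col_mxEu mxE.
    have := is_derive_coord (lshift m k) (ysol ttau).
    by rewrite /magnetic_field /linearized_field !col_mxEu /yL col_mxKu.
  rewrite (_ : (fun s => _) = fun s => d s k 0); last first.
    by apply/funext => u; rewrite /yL col_mxEd.
  have := is_derive_coord k (dd t ttau).
  by rewrite /linearized_field col_mxEd /yL col_mxKu col_mxKd.
have tau_neq0 : tau != 0 by rewrite gt_eqF.
have [kst kup] := @linearized_stages R s m a L b tau q0 d0 tau_neq0.
have := order_linearized _ _ yLsol; rewrite yL0 => /(_ _ _ _ kst).
rewrite kup; apply; first by rewrite tau_gt0.
by exists (y 0, d0).
Qed.

Lemma position_error :
  `|usubmx (y tau) - num_flow a L b tau q0| <= C1 * tau ^+ nu.+1.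
Proof.
have [|d [_ _]] := @linearized_error 0; first by rewrite normr0.
by apply: le_trans; rewrite opp_col_mx add_col_mx -{1}[X in `|X|](col_mxKu _
  (d tau - Bt^T *m 0)) norm_usubmx_le.
Qed.

(** Testing B p(tau) - p(0) against the j-th basis vector: by the conserved
    pairing it is the error of the linearized method started in that vector,
    paired with p(tau). *)
Lemma momentum_error : `|Bt *m dsubmx (y tau) - dsubmx (y 0)|
  <= m%:R * (C1 * tau ^+ nu.+1) * (rho + 1).
Proof.
have y_le : `|y tau| <= rho + 1.
  by apply: (solution_bounded tau_le0 Ky ysol); rewrite lexx ltW.
have C1_ge0 : 0 <= C1 * tau ^+ nu.+1 := le_trans (normr_ge0 _) position_error.
apply: norm_le_coord => [|j u].
  by apply: mulr_ge0; [exact: mulr_ge0|exact: addr_ge0].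
rewrite ord1.
have e1 : `|delta_mx j 0 : 'cV[R]_m| <= 1.
  apply: norm_le_coord => // k l; rewrite mxE.
  by case: (_ && _); rewrite ?normr1 ?normr0.
have [d [d0 dd derr]] := linearized_error e1.
have dp t : 0 <= t <= tau ->
    is_derive t (1 : R) (fun t => dsubmx (y t)) ((jacobi a (usubmx (y t)))^T *m dsubmx (y t)).
  move=> ttau; apply: is_derive_col => i.
  rewrite (_ : (fun s => _) = fun s => y s (rshift m i) 0); last first.
    by apply/funext => v; rewrite mxE.
  have := is_derive_coord (rshift m i) (ysol ttau).
  by rewrite /magnetic_field col_mxEd.
have pc := pairing_constant (ltW tau_gt0) dp dd.
have p0 : dsubmx (y 0) j 0 = \sum_l dsubmx (y tau) l 0 * d tau l 0.
  rewrite pc d0 (bigD1 j)//= big1 ?addr0; first by rewrite [delta_mx _ _ _ _]mxE !eqxx mulr1.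
  by move=> l lj; rewrite [delta_mx _ _ _ _]mxE (negbTE lj) mulr0.
rewrite mxE [X in _ + X]mxE p0 [X in X - _]mxE -sumrB.
rewrite (le_trans (ler_norm_sum _ _ _))//.
apply: (@le_trans _ _ (\sum_(l < m) C1 * tau ^+ nu.+1 * (rho + 1))); last first.
  by rewrite sumr_const card_ord -[X in X <= _]mulr_natl mulrA.
apply: ler_sum => l _; rewrite [X in _ - X]mulrC -mulrBl normrM ler_pM//; last first.
  by rewrite (le_trans (coord_le_norm _ _ _))// (le_trans (norm_dsubmx_le _)).
apply: le_trans derr; rewrite distrC opp_col_mx add_col_mx.
apply: le_trans (coord_le_norm _ (rshift m l) 0).
rewrite col_mxEd [leRHS](_ : _ = `|d tau l 0 - Bt j l|)//.
by rewrite -colE !mxE.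
Qed.

End along_solution.

(** The order of the method controls the error only up to a step size that
    depends on nu. Beyond it the solution and the numerical step are merely
    bounded, which suffices because tau^(nu+1) is then bounded below. *)
Lemma local_error nu : rk_order L b nu -> exists C : R, forall tau z,
  0 < tau <= tau0 -> K z -> prk_local_error_le a L Lh b tau z (C * tau ^+ nu.+1).
Proof.
move=> ord.
pose KL : set 'cV[R]_(m + m) :=
  (fun x : 'cV[R]_(m + m) * 'cV[R]_m => col_mx (usubmx x.1) x.2) @`
    (K `*` [set v | `|v| <= 1]).
have KLc : compact KL.
  apply: continuous_compact; last by apply: compact_setX => //; exact: ball_compact.
  apply: continuous_subspaceT => x; apply: continuous_mxP => i j; rewrite ord1.
  case: (split_ordP i) => k ->.
    rewrite (_ : (fun y => _) = (fun z => usubmx z k 0) \o fst); last first.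
      by apply/funext => u /=; rewrite col_mxEu.
    apply: continuous_comp; first exact: cvg_fst.
    by have := @Ck_usubmx R m 0 k; exact.
  rewrite (_ : (fun y => _) = (fun v : 'cV[R]_m => v k 0) \o snd); last first.
    by apply/funext => u /=; rewrite col_mxEd.
  by apply: continuous_comp; [exact: cvg_snd|exact: coord_continuous].
have [C1 [tau1 [tau1_gt0 H1]]] := ord _ _ (linearized_field_smooth sa) KL KLc.
have [CP [CI [CP0 CI0 bounds]]] := numerical_bounds.
have rho1 : 0 <= rho + 1 by rewrite addr_ge0.
have [|jac jac0 Hjac] := compact_norm_bound (f := fun z => jacobi a (usubmx z))
  (@ball_compact R (m + m) _ rho1).
  by move=> x i j _; have := Ck_jacobi_usubmx sa 0 i j; exact.
pose J := m%:R * jac.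
have J0 : 0 <= J by rewrite mulr_ge0.
(* below tau2 the linearized equation is solved by Picard iteration *)
pose tau2 := Num.min tau1 (2 * (J + 1))^-1.
have J1 : 0 < J + 1 by rewrite ltr_wpDl.
have tau2_gt0 : 0 < tau2 by rewrite lt_min tau1_gt0 invr_gt0 mulr_gt0.
pose Csmall := `|C1| + m%:R * CI * (m%:R * `|C1| * (rho + 1)).
pose big := rho + 1 + (CP + m%:R * CI * rho).
pose Cbig := big / tau2 ^+ nu.+1.
have small0 : 0 <= m%:R * CI * (m%:R * `|C1| * (rho + 1)) by rewrite !mulr_ge0.
have Csmall0 : 0 <= Csmall by rewrite addr_ge0.
have big0 : 0 <= big by rewrite !addr_ge0// !mulr_ge0.
have Cbig0 : 0 <= Cbig by rewrite divr_ge0// exprn_ge0// ltW.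
exists (Csmall + Cbig) => tau z /andP[t0 tt0] Kz y w y0 ysol step.
have ttau : 0 <= tau <= tau0 by rewrite ltW.
have U := tangent_unit ttau Kz.
have [bP bI] := bounds _ _ ttau Kz.
move/(step_iff L_lower b_neq0 w U) : step => ->.
have Ky : K (y 0) by rewrite y0.
have tn0 : 0 <= tau ^+ nu.+1 by rewrite exprn_ge0// ltW.
have yE : y tau = col_mx (usubmx (y tau)) (dsubmx (y tau)) by rewrite vsubmxK.
have [tle|tgt] := leP tau tau2.
  apply: (@le_trans _ _ (Csmall * tau ^+ nu.+1)); last first.
    by rewrite ler_wpM2r// lerDl.
  have tle1 : tau <= tau1 by rewrite (le_trans tle)// ge_min lexx.
  have tJ : m%:R * jac * tau <= 2^-1.
    apply: (@le_trans _ _ (J * (2 * (J + 1))^-1)).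
      by rewrite ler_wpM2l// (le_trans tle)// ge_min lexx orbT.
    by rewrite invfM mulrCA ler_piMr// ler_pdivrMr// mul1r lerDl.
  have perr := @position_error nu C1 tau1 jac jac0 Hjac H1 tau y t0 tt0 tle1 tJ Ky ysol.
  have merr := @momentum_error nu C1 tau1 jac jac0 Hjac H1 tau y t0 tt0 tle1 tJ Ky ysol.
  rewrite y0 in perr merr.
  have C1le : C1 * tau ^+ nu.+1 <= `|C1| * tau ^+ nu.+1 by rewrite ler_wpM2r// ler_norm.
  rewrite yE opp_col_mx add_col_mx; apply: norm_col_mx_le; first exact: mulr_ge0.
    rewrite (le_trans perr)// (le_trans C1le)// ler_wpM2r//.
    by rewrite /Csmall lerDl.
  have -> : dsubmx (y tau) - invmx (num_tangent a L b tau (usubmx z)) *m dsubmx z =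
     invmx (num_tangent a L b tau (usubmx z)) *m
      (num_tangent a L b tau (usubmx z) *m dsubmx (y tau) - dsubmx z).
    by rewrite mulmxBr mulKmx.
  rewrite (le_trans (norm_mulmx_le _ _))//.
  apply: (@le_trans _ _ (m%:R * CI * (m%:R * (`|C1| * tau ^+ nu.+1) * (rho + 1)))).
    apply: ler_pM; [exact: mulr_ge0|exact: normr_ge0|by rewrite ler_wpM2l|].
    by rewrite (le_trans merr)// ler_wpM2r// ler_wpM2l.
  rewrite /Csmall mulrDl -[X in X <= _]add0r lerD//; first exact: mulr_ge0.
  by rewrite le_eqVlt; apply/orP; left; apply/eqP; ring.
apply: (@le_trans _ _ (Cbig * tau ^+ nu.+1)); last by rewrite ler_wpM2r// lerDr.
apply: (@le_trans _ _ big); last first.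
  rewrite /Cbig -mulrA ler_peMr// mulrC ler_pdivlMr ?exprn_gt0// mul1r.
  by rewrite lerXn2r ?nnegrE ?ltW.
rewrite (le_trans (ler_normB _ _))// lerD//.
  by apply: (solution_bounded tt0 Ky ysol); rewrite lexx ltW.
have CIr : 0 <= m%:R * CI * rho by rewrite !mulr_ge0.
apply: norm_col_mx_le; first by rewrite addr_ge0.
  by rewrite (le_trans bP)// lerDl.
rewrite (le_trans (norm_mulmx_le _ _))// -[X in X <= _]add0r lerD//.
apply: ler_pM; [exact: mulr_ge0|exact: normr_ge0|by rewrite ler_wpM2l|].
by rewrite (le_trans (norm_dsubmx_le _))// K_rho.
Qed.

End local_error.

(** * A uniform step size on a compact set *)

Lemma num_tangent0 (R : realType) s m (a : 'cV[R]_m -> 'cV[R]_m) (L : 'M[R]_s)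
    (b : 'cV[R]_s) q : num_tangent a L b 0 q = 1%:M.
Proof.
rewrite /num_tangent rho_polyE big1 ?addr0// => i _.
by rewrite tangentE /num_jac scale0r mulmx0 scaler0.
Qed.

(** The determinant is jointly continuous in the step size and the position, and
    is 1 at step size 0; K being compact, it cannot vanish for small steps. *)
Lemma num_tangent_unit (R : realType) s m (a : 'cV[R]_m -> 'cV[R]_m) (L : 'M[R]_s)
    (b : 'cV[R]_s) (K : set 'cV[R]_(m + m)) : smooth_field a -> compact K ->
  exists2 e, 0 < e & forall tau z, 0 <= tau <= e -> K z ->
    num_tangent a L b tau (usubmx z) \in unitmx.
Proof.
move=> sa cK; pose X := (R * 'cV[R]_(m + m))%type.
have [x _|z _|e e0 He] := @compact_tube R _ K (fun x : X =>
    \det (num_tangent a L b x.1 (usubmx x.2))) cK.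
- have C1 : {for (0, x) : X, continuous (fun y : X => y.1)} by exact: cvg_fst.
  have Cq i : {for (0, x) : X, continuous (fun y : X => usubmx y.2 i 0)}.
    apply: (@continuous_comp _ _ _ snd (fun z => usubmx z i 0)).
      exact: cvg_snd.
    by have := @Ck_usubmx R m 0 i; exact.
  have HC := @continuous_smooth_class R X (0, x).
  have CB u v : {for (0, x) : X, continuous (fun y : X =>
      num_tangent a L b y.1 (usubmx y.2) u v)}.
    exact: (class_num_tangent L b sa HC C1 Cq).
  exact: (class_det HC CB).
- by rewrite num_tangent0 det1 oner_neq0.
by exists e => // tau z tt Kz; rewrite unitmxE unitfE; exact: (He tau z tt Kz).
Qed.

Theorem theorem4p5 (R : realType) (d s : nat)
    (A : 'cV[R]_d -> 'cV[R]_d) (L : 'M[R]_s) (b : 'cV[R]_s)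
    (K : set 'cV[R]_(dimD d + dimD d))
    (A_smooth : smooth_field A)
    (A_bounded : forall i, bounded_partials 1 (fun x => A x i 0))
    (L_lower : strictly_lower L)
    (b_neq0 : forall i, b i 0 != 0)
    (K_compact : compact K) :
  let a := avg_potential A in
  let Lh := symplectic_companion L b in
  exists (tau0 : R) (P : ncpoly R s), 0 < tau0 /\
    forall (V : 'cV[R]_d -> R) (nu : nat),
      smooth V ->
      bounded_partials 2 (fun x => V x + 1 / 2 * sqnorm (A x)) ->
      rk_order L b nu ->
      exists C : R, forall (tau : R) (N : nat)
          (z : nat -> 'cV[R]_(dimD d + dimD d)),
        0 < tau <= tau0 ->
        prk_trajectory a L Lh b tau N z ->
        (forall n, (n <= N)%N -> K (z n)) ->
        forall n, (n <= N)%N ->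
          [/\ prk_well_defined a L Lh tau (z n),
              prk_explicit a L Lh b tau P (z n),
              prk_symplectic a L Lh b tau (z n) &
              prk_local_error_le a L Lh b tau (z n) (C * tau ^+ nu.+1)].
Proof.
move=> a Lh.
have sa : smooth_field a := avg_potential_smooth A_smooth A_bounded.
have [|rho rho0 Krho] := compact_norm_bound (f := id) K_compact.
  by move=> x i j _; exact: coord_continuous.
have rho1 : 0 <= rho + 1 by rewrite addr_ge0.
have [|speed speed0 Hspeed] := compact_norm_bound (f := magnetic_field a)
  (ball_compact rho1).
  by move=> x i j _; rewrite ord1; exact: magnetic_field_continuous.
have [e e0 unit] := num_tangent_unit L b sa K_compact.
have speed1 : 0 < speed + 1 by rewrite ltr_wpDl.
pose tau0 := Num.min e (speed + 1)^-1.
have tau0_gt0 : 0 < tau0 by rewrite lt_min e0 invr_gt0.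
have tau0_speed : speed * tau0 < 1.
  apply: (@le_lt_trans _ _ (speed * (speed + 1)^-1)).
    by rewrite ler_wpM2l// ge_min lexx orbT.
  by rewrite ltr_pdivrMr// mul1r ltrDl.
have unit0 tau z : 0 <= tau <= tau0 -> K z ->
    num_tangent a L b tau (usubmx z) \in unitmx.
  move=> /andP[t0 tt]; apply: unit.
  by rewrite t0 (le_trans tt)// ge_min lexx.
exists tau0, (rho_poly L b); split=> // V nu _ _ ord.
have [C HC] := local_error sa L_lower b_neq0 K_compact rho0 Krho speed0 Hspeed
  tau0_speed unit0 ord.
exists C => tau N z /andP[t0 tt] _ Kz n /Kz Kn.
have U : num_tangent a L b tau (usubmx (z n)) \in unitmx.
  by apply: unit0 => //; rewrite ltW.
split; [exact: step_well_defined|exact: step_explicit|exact: step_symplectic|].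
by apply: HC => //; rewrite t0.
Qed.
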